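(* Let $k$ be an infinite field of characteristic $p>0$. Let $R$ be one of the following regular rings: (i) $k[Y_1,\ldots,Y_d]$; (ii) $k[[Y_1,\ldots,Y_d]]$. Let $\mathcal{M}$ be an $F_R$-finite module. Then the Koszul homology modules $H_i(Y_1,\ldots,Y_d;\mathcal{M})$ are finite dimensional $k$-vector spaces for $i=0,\ldots,d$.
   Context: For a regular (commutative Noetherian) ring $R$ of characteristic $p>0$, let $R'$ be the $R$-bimodule which is $R$ as a left $R$-module and has right action $r'\cdot r=r^pr'$. For an $R$-module $M$ set $F(M)=R'\otimes_R M$, an $R$-module via the left structure on $R'$. An $F_R$-module is a pair $(\mathcal{M},\theta)$ with $\mathcal{M}$ an $R$-module and $\theta\colon\mathcal{M}\to F(\mathcal{M})$ an $R$-module isomorphism. It is $F_R$-finite if there are a finitely generated $R$-module $M$ and an $R$-linear map $\beta\colon M\to F(M)$ such that $\mathcal{M}$ is the direct limit of $M\xrightarrow{\beta}F(M)\xrightarrow{F(\beta)}F^2(M)\to\cdots$, with $\theta$ induced by the vertical maps $F^j(\beta)\colon F^j(M)\to F^{j+1}(M)$ from this system to the system $F(M)\to F^2(M)\to F^3(M)\to\cdots$. *)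

(* Defs.v *)
From HB Require Import structures.
From mathcomp Require Import all_boot all_order all_algebra.
From mathcomp Require Import boolp classical_sets functions cardinality.
From mathcomp Require Import freeg mpoly.

Set Implicit Arguments.
Unset Strict Implicit.
Unset Printing Implicit Defensive.

Import GRing.Theory Quotient.

Local Open Scope ring_scope.
Local Open Scope quotient_scope.

(** * Quotient of a module by the submodule spanned by a set of vectors *)

Section QuotientModule.
Variables (R : comNzRingType) (V : lmodType R) (G : V -> Prop).

Definition spanned (v : V) : Prop :=
  exists2 s : seq (R * V),
    (forall z, z \in s -> G z.2) & v = \sum_(z <- s) z.1 *: z.2.

Definition span_pred : {pred V} := fun v => `[< spanned v >].

Lemma span_submod_closed : submod_closed span_pred.
Proof.
split=> [|c u v]; first by apply/asboolP; exists [::]; rewrite ?big_nil.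
move=> /asboolP[s hs ->] /asboolP[t ht ->]; apply/asboolP.
exists ([seq (c * z.1, z.2) | z <- s] ++ t) => [z|].
  by rewrite mem_cat => /orP[/mapP[w /hs Gw ->]//|/ht].
rewrite big_cat big_map scaler_sumr; congr (_ + _).
by apply: eq_bigr => z _; rewrite scalerA.
Qed.

HB.instance Definition _ :=
  GRing.isSubmodClosed.Build R V span_pred span_submod_closed.

Lemma span_gen v : G v -> v \in span_pred.
Proof.
move=> Gv; apply/asboolP; exists [:: (1, v)]; last by rewrite big_seq1 scale1r.
by move=> z; rewrite inE => /eqP ->.
Qed.

Definition quotmod : Type := {quot span_pred}.
HB.instance Definition _ := GRing.Zmodule.on quotmod.

Definition quotmod_pi (v : V) : quotmod := \pi_{quot span_pred} v.

Lemma quotmod_piP u v : quotmod_pi u = quotmod_pi v <-> u - v \in span_pred.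
Proof.
rewrite (idealrBE span_pred u v).
by split=> [/eqP//|/eqP].
Qed.

Lemma quotmod_reprK (q : quotmod) : quotmod_pi (repr (q : {quot span_pred})) = q.
Proof. exact: reprK. Qed.

Lemma quotmod_pi_is_zmod : zmod_morphism quotmod_pi.
Proof. exact: (raddfB \pi_{quot span_pred}). Qed.
HB.instance Definition _ :=
  GRing.isZmodMorphism.Build V quotmod quotmod_pi quotmod_pi_is_zmod.

Definition quotmod_scale (c : R) (q : quotmod) : quotmod :=
  quotmod_pi (c *: repr (q : {quot span_pred})).

Lemma quotmod_pi_scale c v : quotmod_scale c (quotmod_pi v) = quotmod_pi (c *: v).
Proof.
apply/quotmod_piP; rewrite -scalerBr rpredZ//.
by apply/quotmod_piP; rewrite quotmod_reprK.
Qed.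

Lemma quotmod_scaleA a b q :
  quotmod_scale a (quotmod_scale b q) = quotmod_scale (a * b) q.
Proof. by rewrite -[q]quotmod_reprK !quotmod_pi_scale scalerA. Qed.

Lemma quotmod_scale1 : left_id 1 quotmod_scale.
Proof. by move=> q; rewrite -[q]quotmod_reprK quotmod_pi_scale scale1r. Qed.

Lemma quotmod_scaleDr : right_distributive quotmod_scale +%R.
Proof.
move=> c q r; rewrite -[q]quotmod_reprK -[r]quotmod_reprK -raddfD.
by rewrite !quotmod_pi_scale scalerDr raddfD.
Qed.

Lemma quotmod_scaleDl q : {morph quotmod_scale^~ q : a b / a + b}.
Proof.
move=> a b /=; rewrite -[q]quotmod_reprK !quotmod_pi_scale scalerDl.
by rewrite raddfD.
Qed.

HB.instance Definition _ := GRing.Zmodule_isLmodule.Build R quotmod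
  quotmod_scaleA quotmod_scale1 quotmod_scaleDr quotmod_scaleDl.

Lemma quotmod_pi_is_scalable : scalable quotmod_pi.
Proof. by move=> c v; rewrite -quotmod_pi_scale. Qed.
HB.instance Definition _ :=
  GRing.isScalable.Build R V quotmod *:%R quotmod_pi quotmod_pi_is_scalable.

Section Lift.
Variables (W : lmodType R) (h : {linear V -> W}).
Hypothesis h0 : forall v, G v -> h v = 0.

Definition quotmod_lift of (forall v, G v -> h v = 0) : quotmod -> W :=
  fun q => h (repr (q : {quot span_pred})).

Lemma quotmod_liftE v : quotmod_lift h0 (quotmod_pi v) = h v.
Proof.
apply/eqP; rewrite -subr_eq0 -linearB.
have /quotmod_piP/asboolP[s hs ->] := quotmod_reprK (quotmod_pi v).
rewrite linear_sum big_seq big1// => z /hs Gz.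
by rewrite linearZ_LR (h0 Gz) scaler0.
Qed.

Lemma quotmod_lift_is_linear : linear (quotmod_lift h0).
Proof.
move=> c q r; rewrite -[q]quotmod_reprK -[r]quotmod_reprK -linearP.
by rewrite !quotmod_liftE linearP.
Qed.
HB.instance Definition _ :=
  GRing.isLinear.Build R quotmod W *:%R (quotmod_lift h0) quotmod_lift_is_linear.
End Lift.

End QuotientModule.

(** * The Frobenius functor *)

Section FreegLift.
Variables (R : comNzRingType) (K : choiceType) (W : lmodType R) (f : K -> W).

Lemma fglift_is_linear : linear (fglift f).
Proof.
have fgliftB : {morph fglift f : D E / D - E} by exact: lift_is_additive.
have fglift0 : fglift f 0 = 0 by rewrite -[X in fglift f X](subrr 0) fgliftB subrr.
have fgliftD : {morph fglift f : D E / D + E}.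
  by move=> D E; rewrite -[E in LHS]opprK -[- E]sub0r !fgliftB fglift0 sub0r opprK.
have fgliftE (c : K -> R) s :
    fglift f (\sum_(x <- s) << c x *g x >>) = \sum_(x <- s) c x *: f x.
  by rewrite (big_morph _ fgliftD fglift0); apply: eq_bigr => x _; rewrite liftU.
move=> c D E; rewrite fgliftD; congr (_ + _).
rewrite [c *: D]/(fgscale c D) fgliftE -[in RHS](freeg_sumE D) fgliftE.
by rewrite scaler_sumr; apply: eq_bigr => x _; rewrite scalerA.
Qed.
HB.instance Definition _ :=
  GRing.isLinear.Build R {freeg K / R} W *:%R (fglift f) fglift_is_linear.
End FreegLift.

Section Frobenius.
Variables (p : nat) (R : comNzRingType).

(* Relations presenting R' (x)_R M over the free left R-module on R' x M. The
   third one is balancedness, a.r (x) m = a (x) r m, for the right action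
   a.r = r^p a of R on R'; the last one defines the left action of R. The
   right action is additive in r only when R has characteristic p, which is
   the only case of interest. *)
Inductive frob_rel (M : lmodType R) : {freeg (R * M)%type / R} -> Prop :=
| frob_rel_addl a b m :
    frob_rel (<< (a + b, m) >> - (<< (a, m) >> + << (b, m) >>))
| frob_rel_addr a m n :
    frob_rel (<< (a, m + n) >> - (<< (a, m) >> + << (a, n) >>))
| frob_rel_mid a r m :
    frob_rel (<< (r ^+ p * a, m) >> - << (a, r *: m) >>)
| frob_rel_left r a m :
    frob_rel (<< (r * a, m) >> - r *: << (a, m) >>).

Definition frobF (M : lmodType R) : lmodType R := quotmod (@frob_rel M).

Definition frob_tensor (M : lmodType R) (a : R) (m : M) : frobF M :=
  quotmod_pi (@frob_rel M) << (a, m) >>.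

Section Map.
Variables (M N : lmodType R) (g : {linear M -> N}).

Definition frob_tensor_map (x : R * M) : frobF N := frob_tensor x.1 (g x.2).

Lemma frob_tensor_map_rel v :
  frob_rel v -> fglift frob_tensor_map v = 0.
Proof.
pose f : {linear _ -> _} := fglift frob_tensor_map.
have f1 x : f << x >> = frob_tensor_map x by rewrite [LHS]liftU scale1r.
pose q : {linear _ -> _} := quotmod_pi (@frob_rel N).
rewrite -[fglift _ _]/(f _) => fv.
case: fv => [a b m|a m n|a r m|r a m]; rewrite (linearB f) !f1;
  apply/eqP; rewrite subr_eq0; apply/eqP.
- rewrite (linearD f) !f1 -(linearD q).
  exact/quotmod_piP/span_gen/frob_rel_addl.
- rewrite (linearD f) !f1 /frob_tensor_map /= linearD -(linearD q).
  exact/quotmod_piP/span_gen/frob_rel_addr.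
- rewrite /frob_tensor_map /= linearZ_LR.
  exact/quotmod_piP/span_gen/frob_rel_mid.
rewrite (linearZ_LR f) f1 -(linearZ_LR q).
exact/quotmod_piP/span_gen/frob_rel_left.
Qed.

Definition frobF_map : {linear frobF M -> frobF N} :=
  quotmod_lift frob_tensor_map_rel.

Lemma frobF_mapE a m : frobF_map (frob_tensor a m) = frob_tensor a (g m).
Proof. by rewrite [LHS]quotmod_liftE [LHS]liftU scale1r. Qed.
End Map.

Fixpoint frobF_iter (M : lmodType R) (j : nat) : lmodType R :=
  if j is j'.+1 then frobF (frobF_iter M j') else M.

Fixpoint frobF_iter_map (M : lmodType R) (beta : {linear M -> frobF M})
    (j : nat) : {linear frobF_iter M j -> frobF_iter M j.+1} :=
  if j is j'.+1 then frobF_map (frobF_iter_map beta j') else beta.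

End Frobenius.

(** * F_R-modules *)

Section Modules.
Variable R : comNzRingType.

Definition fin_gen (M : lmodType R) : Prop :=
  exists n (e : 'I_n -> M), forall x, exists c : 'I_n -> R,
    x = \sum_(i < n) c i *: e i.

Definition is_direct_limit (V : nat -> lmodType R)
    (t : forall j, {linear V j -> V j.+1})
    (L : lmodType R) (phi : forall j, {linear V j -> L}) : Prop :=
  (forall j x, phi j.+1 (t j x) = phi j x) /\
  (forall (W : lmodType R) (g : forall j, {linear V j -> W}),
     (forall j x, g j.+1 (t j x) = g j x) ->
     exists2 h : {linear L -> W}, (forall j x, h (phi j x) = g j x) &
       forall h' : {linear L -> W},
         (forall j x, h' (phi j x) = g j x) -> h' =1 h).

Variable p : nat.

Record F_module := FModule {
  F_module_sort :> lmodType R;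
  frob_theta : {linear F_module_sort -> frobF p F_module_sort};
  frob_theta_bij : bijective frob_theta
}.

(* The target system F(M) -> F^2(M) -> ... of the vertical maps F^j(beta) has
   limit F(L) through the maps F(phi_j), so the map they induce on limits is
   the theta determined by theta \o phi_j = F(phi_j) \o F^j(beta). *)
Definition F_finite (L : F_module) : Prop :=
  exists (M : lmodType R) (beta : {linear M -> frobF p M})
         (phi : forall j, {linear frobF_iter p M j -> L}),
    [/\ fin_gen M,
        is_direct_limit (frobF_iter_map beta) phi &
        forall j x, frob_theta L (phi j x) =
                    frobF_map p (phi j) (frobF_iter_map beta j x)].

End Modules.

(** * Koszul homology *)

Section Kernel.
Variables (R : comNzRingType) (U V : lmodType R) (g : {linear U -> V}).

Definition ker_pred : {pred U} := fun x => g x == 0.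

Lemma ker_submod_closed : submod_closed ker_pred.
Proof.
split=> [|c x y]; rewrite !unfold_in ?raddf0// => /eqP gx /eqP gy.
by rewrite linearP gx gy scaler0 addr0.
Qed.
HB.instance Definition _ :=
  GRing.isSubmodClosed.Build R U ker_pred ker_submod_closed.

Definition lkernel : Type := {x | x \in ker_pred}.
HB.instance Definition _ := SubChoice.on lkernel.
HB.instance Definition _ := [SubChoice_isSubLmodule of lkernel by <:].
End Kernel.

Section Koszul.
Variables (R : comNzRingType) (n : nat) (y : 'I_n -> R) (M : lmodType R).

(* The i-subset {j_1 < ... < j_i} stands for the basis vector
   e_{j_1} /\ ... /\ e_{j_i} of the i-th exterior power of R^n. *)
Definition koszul (i : nat) : lmodType R :=
  {ffun {S : {set 'I_n} | #|S| == i} -> M}.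

(* d(m e_S) = \sum_(j in S) (-1)^#{t in S, t < j} y_j m e_(S \ j); this is 0
   in degree 0. *)
Definition koszul_diff (i : nat) (x : koszul i) : koszul i.-1 :=
  [ffun T => \sum_(S : {S : {set 'I_n} | #|S| == i})
     \sum_(j in val S | val S :\ j == val T)
       ((-1) ^+ #|[set t in val S | (t < j)%N]| * y j) *: x S].

Lemma koszul_diff_is_linear i : linear (@koszul_diff i).
Proof.
move=> c u v; apply/ffunP => T; rewrite !ffunE scaler_sumr -big_split.
apply: eq_bigr => S _; rewrite scaler_sumr -big_split.
apply: eq_bigr => j _; rewrite !ffunE /= scalerDr !scalerA.
by rewrite [c * _]mulrC.
Qed.
HB.instance Definition _ i := GRing.isLinear.Build R (koszul i) (koszul i.-1)
  *:%R (@koszul_diff i) (koszul_diff_is_linear (i:=i)).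

Definition koszul_boundary (i : nat) (z : lkernel (@koszul_diff i)) : Prop :=
  exists x : koszul i.+1, val z = koszul_diff x.

Definition koszul_homology (i : nat) : lmodType R :=
  quotmod (@koszul_boundary i).
End Koszul.

(** * Finite dimensionality over the coefficient field *)

Section Scalars.
Variables (k : fieldType) (A : comAlgType k) (V : lmodType A).

Definition res_scalars : Type := V.
HB.instance Definition _ := GRing.Zmodule.on res_scalars.

Definition res_scale (c : k) (v : res_scalars) : res_scalars :=
  (c%:A : A) *: (v : V).

Lemma res_scaleA a b v : res_scale a (res_scale b v) = res_scale (a * b) v.
Proof. by rewrite /res_scale scalerA -scalerAl mul1r scalerA. Qed.
Lemma res_scale1 : left_id 1 res_scale.
Proof. by move=> v; rewrite /res_scale !scale1r. Qed.
Lemma res_scaleDr : right_distributive res_scale +%R.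
Proof. by move=> c u v; rewrite /res_scale scalerDr. Qed.
Lemma res_scaleDl v : {morph res_scale^~ v : a b / a + b}.
Proof. by move=> a b; rewrite /res_scale !scalerDl. Qed.
HB.instance Definition _ := GRing.Zmodule_isLmodule.Build k res_scalars
  res_scaleA res_scale1 res_scaleDr res_scaleDl.

Definition fin_dim : Prop := exists n, inhabited (Vector.axiom n res_scalars).
End Scalars.

(** * Formal power series in several variables *)

Record mfps (n : nat) (k : fieldType) := MFps { mfps_coef : 'X_{1..n} -> k }.
HB.instance Definition _ n k := [isNew for @mfps_coef n k].
HB.instance Definition _ n k := [Choice of mfps n k by <:].

Section PowerSeries.
Variables (n : nat) (k : fieldType).
Implicit Types (f g h : mfps n k) (m : 'X_{1..n}).

Lemma mfpsP f g : mfps_coef f =1 mfps_coef g -> f = g.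
Proof. by move=> /funext fg; apply: val_inj. Qed.

Definition mfps_add f g := MFps (fun m => mfps_coef f m + mfps_coef g m).
Definition mfps_opp f := MFps (fun m => - mfps_coef f m).
Definition mfps_const (c : k) : mfps n k :=
  MFps (fun m => if m == 0%MM then c else 0).
Definition mfps_scale c f := MFps (fun m => c * mfps_coef f m).
(* Cauchy product: the sum over all pairs of exponents adding up to m, which
   both have degree at most that of m. *)
Definition mfps_mul f g := MFps (fun m =>
  \sum_(a : 'X_{1..n < (mdeg m).+1, (mdeg m).+1} | m == (a.1 + a.2)%MM)
    (mfps_coef f a.1 * mfps_coef g a.2)).
Definition mfpsX (i : 'I_n) : mfps n k :=
  MFps (fun m => if m == U_(i)%MM then 1 else 0).

Lemma mfps_addA : associative mfps_add.
Proof. by move=> f g h; apply: mfpsP => m /=; rewrite addrA. Qed.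
Lemma mfps_addC : commutative mfps_add.
Proof. by move=> f g; apply: mfpsP => m /=; rewrite addrC. Qed.
Lemma mfps_add0 : left_id (mfps_const 0) mfps_add.
Proof. by move=> f; apply: mfpsP => m /=; rewrite if_same add0r. Qed.
Lemma mfps_addN : left_inverse (mfps_const 0) mfps_opp mfps_add.
Proof. by move=> f; apply: mfpsP => m /=; rewrite if_same addNr. Qed.
HB.instance Definition _ := GRing.isZmodule.Build (mfps n k)
  mfps_addA mfps_addC mfps_add0 mfps_addN.

Definition mfps_trunc (l : nat) f : {mpoly k[n]} :=
  \sum_(m : 'X_{1..n < l}) mfps_coef f m *: 'X_[m].

Lemma mfps_truncE l f m : (mdeg m < l)%N -> (mfps_trunc l f)@_m = mfps_coef f m.
Proof. exact: mcoeff_mpoly. Qed.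

Lemma mcoeffM_eq (P P' Q Q' : {mpoly k[n]}) m :
  (forall a, (mdeg a <= mdeg m)%N -> P@_a = P'@_a) ->
  (forall a, (mdeg a <= mdeg m)%N -> Q@_a = Q'@_a) ->
  (P * Q)@_m = (P' * Q')@_m.
Proof.
move=> hP hQ; rewrite !mcoeffM; apply: eq_bigr => a _.
by rewrite hP ?hQ// -ltnS bmdeg.
Qed.

Lemma mfps_mulE l f g m : (mdeg m < l)%N ->
  mfps_coef (mfps_mul f g) m = (mfps_trunc l f * mfps_trunc l g)@_m.
Proof.
move=> ml; rewrite mcoeffM; apply: eq_bigr => a _.
by rewrite !mfps_truncE// (leq_trans (bmdeg _)).
Qed.

Lemma mfps_mulA : associative mfps_mul.
Proof.
move=> f g h; apply: mfpsP => m; rewrite !(mfps_mulE _ _ (ltnSn _)).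
set l := (mdeg m).+1.
transitivity (mfps_trunc l f * (mfps_trunc l g * mfps_trunc l h))@_m.
  apply: mcoeffM_eq => // a am.
  by rewrite mfps_truncE// (mfps_mulE (l := l)).
rewrite mulrA; apply: mcoeffM_eq => // a am.
by rewrite mfps_truncE// (mfps_mulE (l := l)).
Qed.

Lemma mfps_mulC : commutative mfps_mul.
Proof.
by move=> f g; apply: mfpsP => m; rewrite !(mfps_mulE _ _ (ltnSn _)) mulrC.
Qed.

Lemma mfps_mul1 : left_id (mfps_const 1) mfps_mul.
Proof.
move=> f; apply: mfpsP => m; rewrite (mfps_mulE _ _ (ltnSn _)).
rewrite -[RHS](mfps_truncE _ (ltnSn _)) -[in RHS](mul1r (mfps_trunc _ f)).
apply: mcoeffM_eq => // a am; rewrite mfps_truncE// mcoeff1 /=.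
by case: eqP.
Qed.

Lemma mfps_mulDl : left_distributive mfps_mul +%R.
Proof.
move=> f g h; apply: mfpsP => m /=; rewrite -big_split.
by apply: eq_bigr => a _; rewrite /= mulrDl.
Qed.

Lemma mfps_oner_neq0 : mfps_const 1 != 0.
Proof.
apply/eqP => /(congr1 (fun f => mfps_coef f 0%MM)) /=; rewrite eqxx.
by apply/eqP/oner_neq0.
Qed.
HB.instance Definition _ := GRing.Zmodule_isComNzRing.Build (mfps n k)
  mfps_mulA mfps_mulC mfps_mul1 mfps_mulDl mfps_oner_neq0.

Lemma mfps_scaleA a b f : mfps_scale a (mfps_scale b f) = mfps_scale (a * b) f.
Proof. by apply: mfpsP => m /=; rewrite mulrA. Qed.
Lemma mfps_scale1 : left_id 1 mfps_scale.
Proof. by move=> f; apply: mfpsP => m /=; rewrite mul1r. Qed.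
Lemma mfps_scaleDr : right_distributive mfps_scale +%R.
Proof. by move=> c f g; apply: mfpsP => m /=; rewrite mulrDr. Qed.
Lemma mfps_scaleDl f : {morph mfps_scale^~ f : a b / a + b}.
Proof. by move=> a b; apply: mfpsP => m /=; rewrite mulrDl. Qed.
HB.instance Definition _ := GRing.Zmodule_isLmodule.Build k (mfps n k)
  mfps_scaleA mfps_scale1 mfps_scaleDr mfps_scaleDl.

Lemma mfps_scaleAl c f g : c *: (f * g) = (c *: f) * g.
Proof.
apply: mfpsP => m /=; rewrite mulr_sumr.
by apply: eq_bigr => a _; rewrite /= mulrA.
Qed.
HB.instance Definition _ :=
  GRing.Lmodule_isLalgebra.Build k (mfps n k) mfps_scaleAl.
HB.instance Definition _ := GRing.Lalgebra_isComAlgebra.Build k (mfps n k).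
End PowerSeries.

(* Main.v *)
From HB Require Import structures.
From mathcomp Require Import all_boot all_order all_algebra.
From mathcomp Require Import boolp classical_sets cardinality.
From mathcomp Require Import finset freeg mpoly ring.
Require Import Defs.

(** The Koszul homology of L is bounded by that of the stages F^j(M) of a system
    M -> F(M) -> F^2(M) -> ... with limit L: a filtered union of images of vector
    spaces of dimension at most b has dimension at most b. So it suffices to bound
    dim_k H_i(Y; F^j(M)) by a number that does not depend on j.

    Let ... -> R^(n_1) -> R^(n_0) -> M -> 0 be a resolution of M by free modules of
    finite rank, which exists because R is Noetherian. Since R is regular, F is
    exact, and F(R^n) = R^n; hence F^j(M) has a resolution with the same ranks for
    every j. As Y is a regular sequence, H_i(Y; -) can be shifted along such a
    resolution: if 0 -> A -> R^n -> C -> 0 is exact then H_(i+1)(Y; C) embeds into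
    H_i(Y; A), and H_0(Y; N) = N / (Y) N has dimension at most the number of
    generators of N. So dim_k H_i(Y; F^j(M)) <= n_i for all j.

    The dimension bound is expressed by [koszul_dep]: any b + 1 cycles have a
    nontrivial k-linear combination that is a boundary. This property passes to
    subobjects and to direct limits without any choice of bases.

    The properties of R that carry this argument are the hypotheses of
    [fin_dim_koszul_F_finite]. They hold for polynomials and for power series for
    the following reasons.
    - Y is a regular sequence with residue field k. Both follow from operators that
      divide a series by Y_j after deleting some of its monomials; these give a
      contracting homotopy of the Koszul complex ([contraction_exists],
      [koszul_acyclic]).
    - Submodules of R^n are finitely generated. For polynomials this is Dickson's
      lemma applied to leading monomials ([mpoly_noetherian]). For power series the
      initial forms (parts of lowest degree) of the elements of a submodule Z span
      a finitely generated module over the polynomial ring, and lifting generators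
      of it degree by degree gives generators of Z ([mfps_submodule_closed]).
    - F is exact. If T : R -> R is additive with T (r^p f) = r T(f) (a Cartier map),
      then a relation sum_i b_i g_i^p = 0 gives sum_i T(b_i) g_i = 0; so it is
      enough to write the b_i as combinations sum_t c_t T_t(b_i)^p with common c_t
      and T_t ([cartier_approx]). The maps T are built from p^-1-linear functionals
      on k, of which enough exist by Zorn's lemma ([pinv_dual_basis]), the degree of k
      over its subfield of p-th powers being possibly infinite. A polynomial has finitely many
      coefficients, and the expression is exact; for power series it is exact only
      up to any given degree, which suffices because submodules of R^n are closed
      for the Y-adic topology, a consequence of the same lifting argument. *)

Set Implicit Arguments.
Unset Strict Implicit.
Unset Printing Implicit Defensive.

Import GRing.Theory.

Local Open Scope ring_scope.

(** * Submodules, spans and p-th powers *)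

Section Submodules.
Variables (A : comNzRingType) (V : lmodType A).
Implicit Types (Z G : V -> Prop).

Definition submodule Z :=
  Z 0 /\ forall (c : A) u v, Z u -> Z v -> Z (c *: u + v).

Lemma submodule_sum Z (I : finType) (c : I -> A) (g : I -> V) :
  submodule Z -> (forall i, Z (g i)) -> Z (\sum_i c i *: g i).
Proof.
move=> [Z0 ZS] Zg; rewrite unlock; elim: (index_enum I) => //= i s IH.
exact: ZS.
Qed.

Lemma submoduleB Z u v : submodule Z -> Z u -> Z v -> Z (u - v).
Proof. by move=> [_ ZS] Zu Zv; rewrite addrC -scaleN1r; apply: ZS. Qed.

Lemma spanned_submodule G : submodule (spanned G).
Proof.
have spanE x : spanned G x <-> x \in span_pred G by split=> /asboolP.
split=> [|c u v]; first by exists [::]; rewrite ?big_nil.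
by rewrite !spanE => Gu Gv; rewrite rpredD ?rpredZ.
Qed.

Lemma spanned_min Z G v :
  submodule Z -> (forall u, G u -> Z u) -> spanned G v -> Z v.
Proof.
move=> [Z0 ZS] GZ [s]; elim: s v => [|x s IH] v sG ->; first by rewrite big_nil.
rewrite big_cons; apply: ZS; first exact/GZ/sG/mem_head.
by apply: IH => // z zs; apply: sG; rewrite inE zs orbT.
Qed.

End Submodules.

Section FrobeniusPower.
Variables (p : nat) (R : comNzRingType).
Hypothesis charRp : p \in [pchar R].

Lemma powpD (x z : R) : (x + z) ^+ p = x ^+ p + z ^+ p.
Proof. by rewrite -!(pFrobenius_autE charRp) rmorphD. Qed.

Lemma powpB (x z : R) : (x - z) ^+ p = x ^+ p - z ^+ p.
Proof. by rewrite -!(pFrobenius_autE charRp) rmorphB. Qed.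

Lemma powp_sum (I : Type) (r : seq I) (F : I -> R) :
  (\sum_(i <- r) F i) ^+ p = \sum_(i <- r) F i ^+ p.
Proof.
rewrite -(pFrobenius_autE charRp) rmorph_sum.
by apply: eq_bigr => i _; rewrite /= pFrobenius_autE.
Qed.

Lemma pchar_gt0 : (0 < p)%N.
Proof. exact/prime_gt0/(pcharf_prime charRp). Qed.

End FrobeniusPower.

(** * The Koszul complex *)

Section KoszulChains.
Variables (R : comNzRingType) (n : nat) (y : 'I_n -> R).
Implicit Types (S T : {set 'I_n}) (i : nat).

(** Chains are handled as functions on all subsets, so that a set can be enlarged
    or shrunk without carrying a proof of its cardinality. *)
Definition kcoef (M : lmodType R) i (x : koszul n M i) S : M :=
  if insub S is Some s then x s else 0.

Definition kchain (M : lmodType R) i (f : {set 'I_n} -> M) : koszul n M i :=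
  [ffun S => f (val S)].

Definition ksign T (j : 'I_n) : nat := #|[set t in T | (t < j)%N]|.

(** The differential computed at T instead of distributed from its source: the
    sets S with S minus a point equal to T are the sets j |: T for j outside T. *)
Definition kdiff (M : lmodType R) (f : {set 'I_n} -> M) T : M :=
  \sum_(j | j \notin T) ((-1) ^+ ksign T j * y j) *: f (j |: T).

Lemma kcoef_val (M : lmodType R) i (x : koszul n M i) s : kcoef x (val s) = x s.
Proof. by rewrite /kcoef valK. Qed.

Lemma kcoefE (M : lmodType R) i (x : koszul n M i) S (Si : #|S| == i) :
  kcoef x S = x (Sub S Si).
Proof. by rewrite /kcoef insubT. Qed.

Lemma kcoef_chain (M : lmodType R) i (f : {set 'I_n} -> M) S :
  #|S| = i -> kcoef (kchain i f) S = f S.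
Proof. by move/eqP => Si; rewrite kcoefE ffunE. Qed.

Lemma koszul_diffE (M : lmodType R) i (x : koszul n M i)
    (T : {S : {set 'I_n} | #|S| == i.-1}) :
  koszul_diff y x T = kdiff (kcoef x) (val T).
Proof.
rewrite ffunE (exchange_big_dep predT) //= /kdiff [RHS]big_mkcond.
apply: eq_bigr => j _; case: ifPn => [jT|].
  have STj S : (j \in S) && (S :\ j == val T) = (S == j |: val T).
    apply/andP/eqP => [[jS /eqP <-]|->]; first by rewrite setD1K.
    by rewrite setU11 setU1K.
  rewrite (eq_bigl (fun s => val s == j |: val T)); last by move=> s; rewrite /= STj.
  have [Ui|Ui] := boolP (#|j |: val T| == i).
    rewrite (big_pred1 (Sub (j |: val T) Ui)) => [|s]; last by rewrite -val_eqE.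
    rewrite kcoefE SubK; congr ((_ ^+ _ * _) *: _).
    apply: eq_card => t; rewrite !inE; case: eqVneq => [->|] //=.
    by rewrite ltnn andbF.
  rewrite big_pred0 => [|s]; last first.
    by apply/negbTE; apply: contraNneq Ui => <-; rewrite (valP s).
  by rewrite /kcoef insubN// scaler0.
rewrite negbK => jT; rewrite big_pred0// => s.
by apply/negbTE; apply: contraTN jT => /andP[_ /eqP <-]; rewrite !inE eqxx.
Qed.

(** The terms are paired off explicitly, an antisymmetric sum being only 2-torsion
    in general. *)
Lemma sum_antisym (M : zmodType) (P : rel 'I_n) (G : 'I_n -> 'I_n -> M) :
  (forall j t, P j t = P t j) -> (forall j t, P j t -> j != t) ->
  (forall j t, P j t -> G t j = - G j t) ->
  \sum_j \sum_(t | P j t) G j t = 0.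
Proof.
move=> Psym Pirr Ganti.
pose A := \sum_(j : 'I_n) \sum_(t : 'I_n | P j t && (j < t)%N) G j t.
have split_lt : \sum_j \sum_(t | P j t) G j t
    = A + \sum_(j : 'I_n) \sum_(t : 'I_n | P j t && (t < j)%N) G j t.
  rewrite -big_split; apply: eq_bigr => j _.
  rewrite (bigID (fun t : 'I_n => (j < t)%N)).
  congr (_ + _); apply: eq_bigl => t; apply: andb_id2l => /Pirr.
  by rewrite -leqNgt leq_eqVlt -val_eqE eq_sym => /negbTE ->.
rewrite split_lt (exchange_big_dep predT) //=; apply/eqP.
rewrite addrC addr_eq0 /A -sumrN; apply/eqP; apply: eq_bigr => j _.
rewrite -sumrN; apply: eq_big => [t|t /andP[Pjt _]]; first by rewrite Psym.
by apply: Ganti; rewrite Psym.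
Qed.

Lemma ksignU T j t : j \notin T -> ksign (j |: T) t = ((j < t) + ksign T t)%N.
Proof.
move=> jT; rewrite /ksign; have [jt|jt] := boolP (j < t)%N.
  have -> : true = (j \notin [set u in T | (u < t)%N]) by rewrite inE (negbTE jT).
  by rewrite -cardsU1; apply: eq_card => u; rewrite !inE; case: eqVneq => [->|].
apply: eq_card => u; rewrite !inE; case: eqVneq => [->|] //=.
by rewrite (negbTE jt) andbF.
Qed.

(** Removing j and then t differs from removing t and then j by a sign, since
    exactly one of the two points lies below the other. *)
Lemma kdiffK (M : lmodType R) (f : {set 'I_n} -> M) T : kdiff (kdiff f) T = 0.
Proof.
pose G j t := ((-1) ^+ ksign T j * y j * ((-1) ^+ ksign (j |: T) t * y t))
  *: f (t |: (j |: T)).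
transitivity (\sum_j \sum_(t | [&& j \notin T, t \notin T & j != t]) G j t).
  rewrite /kdiff big_mkcond; apply: eq_bigr => j _; case: ifP => jT /=; last first.
    by rewrite big_pred0.
  rewrite scaler_sumr; apply: eq_big => [t|t _]; last by rewrite scalerA.
  by rewrite !inE negb_or eq_sym andbC.
apply: sum_antisym => [j t|j t /and3P[]//|j t /and3P[jT tT jt]].
  by rewrite eq_sym [in RHS]andbCA.
rewrite /G !ksignU// setUCA -scaleNr; congr (_ *: _).
rewrite !exprD !mulrA; have := jt; rewrite -val_eqE /= neq_ltn.
by case: ltngtP => //= _ _; rewrite !(expr0, expr1); ring.
Qed.

Lemma kcoef_diff (M : lmodType R) i (x : koszul n M i) S :
  #|S| = i.-1 -> kcoef (koszul_diff y x) S = kdiff (kcoef x) S.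
Proof. by move/eqP => Si; rewrite kcoefE koszul_diffE SubK. Qed.

Lemma koszul_diff0 (M : lmodType R) (x : koszul n M 0) : koszul_diff y x = 0.
Proof.
apply/ffunP => T; rewrite koszul_diffE [RHS]ffunE.
apply: big1 => j jT; rewrite /kcoef insubN ?scaler0//.
by rewrite cardsU1 jT.
Qed.

Lemma koszul_diffK (M : lmodType R) i (x : koszul n M i) :
  koszul_diff y (koszul_diff y x) = 0.
Proof.
case: i x => [|[|i]] x; try exact: koszul_diff0.
apply/ffunP => T; rewrite koszul_diffE [RHS]ffunE.
rewrite -[RHS](kdiffK (kcoef x) (val T)); apply: eq_bigr => j jT.
have Ti : #|val T| = i by apply/eqP/(valP T).
by rewrite kcoef_diff// cardsU1 jT Ti.
Qed.

Definition kmap (M N : lmodType R) (g : M -> N) i (x : koszul n M i) :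
  koszul n N i := [ffun S => g (x S)].

Lemma kmap_diff (M N : lmodType R) (g : {linear M -> N}) i (x : koszul n M i) :
  koszul_diff y (kmap g x) = kmap g (koszul_diff y x).
Proof.
apply/ffunP => T; rewrite !ffunE linear_sum; apply: eq_bigr => S _.
by rewrite linear_sum; apply: eq_bigr => j _; rewrite ffunE linearZ.
Qed.

Lemma kmap_is_linear (M N : lmodType R) (g : {linear M -> N}) i :
  linear (@kmap M N g i).
Proof. by move=> c u v; apply/ffunP => S; rewrite !ffunE linearP. Qed.
HB.instance Definition _ (M N : lmodType R) (g : {linear M -> N}) i :=
  GRing.isLinear.Build R (koszul n M i) (koszul n N i) *:%R (@kmap M N g i)
    (kmap_is_linear g (i := i)).

End KoszulChains.

(** * A contracting homotopy of the Koszul complex *)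

Section Homotopy.
Variables (R : comNzRingType) (d : nat) (y : 'I_d -> R).

(** For R = k[[Y]], pr j keeps the monomials in the variables of index at least j,
    and dv j f is the quotient by Y_j of the part of pr j f that Y_j divides. The
    axioms say how far dv j is from being inverse to multiplication by Y_j. *)
Record contraction (pr : nat -> R -> R) (dv : 'I_d -> {additive R -> R}) : Prop :=
  Contraction {
    contr_pr0 : forall f, pr 0 f = f;
    contr_step : forall (j : 'I_d) f, pr j f = pr j.+1 f + y j * dv j f;
    contr_lt : forall (t j : 'I_d) f, (t < j)%N -> dv j (y t * f) = 0;
    contr_gt : forall (t j : 'I_d) f, (j < t)%N -> dv j (y t * f) = y t * dv j f;
    contr_eq : forall (j : 'I_d) f, dv j (y j * f) = pr j f
  }.

Variables (pr : nat -> R -> R) (dv : 'I_d -> {additive R -> R}).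
Hypothesis ctr : contraction pr dv.

Definition set_min (S : {set 'I_d}) : option 'I_d :=
  [pick j in S | [forall t in S, (j <= t)%N]].

Lemma set_minP (S : {set 'I_d}) (j : 'I_d) :
  j \in S -> (forall t, t \in S -> (j <= t)%N) -> set_min S = Some j.
Proof.
move=> jS jmin; rewrite /set_min; case: pickP => [l /andP[lS /forall_inP lmin]|].
  by congr Some; apply/val_inj/eqP; rewrite eqn_leq lmin ?jmin.
by move/(_ j); rewrite jS; move/negP; case; apply/forall_inP.
Qed.

Lemma set_min_ex (S : {set 'I_d}) : S != set0 ->
  exists2 j, j \in S & forall t, t \in S -> (j <= t)%N.
Proof. by case/set0Pn => t0 tS; case: (arg_minnP val tS) => j ? ?; exists j. Qed.

(** In multidegree u the Koszul complex of R = k[Y] is that of the full simplex on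
    the support of u, which is contracted to a vertex by adding that vertex. The
    vertex chosen is the smallest element of the support; this is why dv m is
    applied, with m = min T, to the coefficient at T minus m. *)
Definition khomotopy (f : {set 'I_d} -> R^o) (T : {set 'I_d}) : R^o :=
  if set_min T is Some j then dv j (f (T :\ j)) else 0.

Lemma pr_sum (j : nat) f : (j <= d)%N ->
  \sum_(t < d | (t < j)%N) y t * dv t f = f - pr j f.
Proof.
elim: j => [|j IH] jd; first by rewrite big_pred0// (contr_pr0 ctr) subrr.
rewrite (bigD1 (Ordinal jd)) //= (eq_bigl (fun t : 'I_d => (t < j)%N)); last first.
  by move=> t; rewrite -val_eqE /= ltnS ltn_neqAle andbC.
rewrite (IH (ltnW jd)).
by have /= -> := contr_step ctr (Ordinal jd) f; ring.
Qed.

(** Let m = min S. In kdiff (khomotopy f) the points j < m contribute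
    Y_j dv_j f_S, which add up to f_S - pr_m f_S by [pr_sum]; in
    khomotopy (kdiff f) the point j = m contributes dv_m (Y_m f_S) = pr_m f_S. The
    points j > m occur in both with opposite signs. *)
Lemma khomotopyP f S : S != set0 ->
  kdiff y (khomotopy f) S + khomotopy (kdiff y f) S = f S.
Proof.
case/set_min_ex => m mS mmin.
rewrite [X in _ + X]/khomotopy (set_minP mS mmin).
have big_lt (F : 'I_d -> R) : \sum_(j | j \notin S) F j
    = \sum_(j < d | (j < m)%N) F j + \sum_(j | (j \notin S) && (m < j)%N) F j.
  rewrite (bigID (fun j : 'I_d => (j < m)%N)) /=; congr (_ + _); apply: eq_bigl => j.
    by apply: andb_idl => jm; apply: contraTN jm => /mmin; rewrite -leqNgt.
  apply: andb_id2l => jS; rewrite -leqNgt ltn_neqAle andb_idl// => _.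
  by apply: contraNneq jS => /val_inj <-.
have sign0 (T : {set 'I_d}) (j : 'I_d) :
    (forall t, t \in T -> (j <= t)%N) -> ksign T j = 0%N.
  move=> jT; apply/eqP; rewrite cards_eq0; apply/eqP/setP => t; rewrite !inE.
  by apply/negbTE; apply/negP => /andP[/jT]; rewrite leqNgt => /negP.
have -> : kdiff y (khomotopy f) S =
   (f S - pr m (f S)) +
   \sum_(j | (j \notin S) && (m < j)%N)
     (-1) ^+ ksign S j * y j * dv m (f (j |: S :\ m)).
  rewrite /kdiff big_lt; congr (_ + _).
    rewrite -(pr_sum _ (ltnW (ltn_ord m))); apply: eq_bigr => j jm.
    have jS t : t \in S -> (j <= t)%N by move/mmin; apply/leq_trans/ltnW.
    have jNS : j \notin S by apply: contraTN jm => /mmin; rewrite -leqNgt.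
    rewrite sign0// expr0 mul1r /khomotopy (@set_minP _ j) ?setU11 ?setU1K//.
    by move=> t; rewrite !inE => /orP[/eqP -> //|/jS].
  apply: eq_bigr => j /andP[jS mj]; rewrite /khomotopy (@set_minP _ m).
  - congr (_ * dv m (f _)); apply/setP => t; rewrite !inE.
    case: (eqVneq t m) => [->|] //=.
    by rewrite orbF -val_eqE /= ltn_eqF.
  - by rewrite !inE mS orbT.
  by move=> t; rewrite !inE => /orP[/eqP -> |/mmin//]; apply: ltnW.
have -> : kdiff y f (S :\ m) = y m * f S +
    (\sum_(j < d | (j < m)%N) y j * f (j |: S :\ m) +
     \sum_(j | (j \notin S) && (m < j)%N)
       - ((-1) ^+ ksign S j * y j * f (j |: S :\ m))).
  rewrite /kdiff (bigD1 m) ?inE ?eqxx //=; congr (_ + _).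
    rewrite sign0 ?expr0 ?mul1r ?setD1K// => t; rewrite !inE => /andP[_].
    exact: mmin.
  rewrite (eq_bigl (fun j => j \notin S)); last first.
    by move=> j; rewrite !inE; case: eqVneq => [->|]; rewrite ?mS ?andbT.
  rewrite big_lt; congr (_ + _); apply: eq_bigr => j.
    move=> jm; rewrite sign0 ?expr0 ?mul1r// => t; rewrite !inE => /andP[_ /mmin].
    by apply/leq_trans/ltnW.
  move=> /andP[jS mj]; rewrite -[in ksign S j](setD1K mS) ksignU ?setD11// mj exprS.
  by rewrite mulN1r !mulNr opprK.
rewrite !raddfD !raddf_sum /= (contr_eq ctr).
rewrite [X in _ + (_ + (X + _))]big1 => [|j jm]; last first.
  by rewrite (contr_lt ctr).
rewrite add0r addrACA subrK -big_split big1 ?addr0//= => j /andP[jS mj].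
rewrite raddfN /= -signr_odd; case: odd.
  by rewrite expr1 !mulN1r !mulNr raddfN opprK (contr_gt ctr)// addNr.
by rewrite expr0 !mul1r (contr_gt ctr)// subrr.
Qed.

(** In positive degree every index set is nonempty, and there the homotopy shows
    that a cycle is the boundary of its image. *)
Lemma koszul_acyclic i (x : koszul d R^o i.+1) :
  koszul_diff y x = 0 -> exists w : koszul d R^o i.+2, x = koszul_diff y w.
Proof.
move=> dx0; exists (kchain i.+2 (khomotopy (kcoef x))).
set w := kchain _ _; apply/ffunP => S.
rewrite [RHS](koszul_diffE y w S) -[LHS](kcoef_val x).
have Sn0 : val S != set0 by rewrite -card_gt0 (eqP (valP S)).
rewrite -(khomotopyP _ Sn0).
have [m mS mmin] := set_min_ex Sn0.
rewrite [X in _ + X]/khomotopy (set_minP mS mmin).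
rewrite -(kcoef_diff y x (S := val S :\ m)); last first.
  by have := eqP (valP S); rewrite (cardsD1 m) mS add1n => /succn_inj.
rewrite dx0 (_ : kcoef 0 _ = 0) ?raddf0 ?addr0; last first.
  by rewrite /kcoef; case: insub => // s; rewrite ffunE.
apply: eq_bigr => j jS; rewrite kcoef_chain// cardsU1 jS.
by rewrite (eqP (valP S)).
Qed.

End Homotopy.

(** * Dimension shifting along a presentation *)

Section FreeModules.
Variables (R : comNzRingType).

Definition fcoord n (l : 'I_n) (v : {ffun 'I_n -> R^o}) : R^o := v l.

Lemma fcoord_is_linear n (l : 'I_n) : linear (fcoord l).
Proof. by move=> c u v; rewrite /fcoord !ffunE. Qed.
HB.instance Definition _ n (l : 'I_n) := GRing.isLinear.Build R
  {ffun 'I_n -> R^o} R^o *:%R (fcoord l) (fcoord_is_linear l).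

Definition fcomb n (V : lmodType R) (e : 'I_n -> V) (v : {ffun 'I_n -> R^o}) : V :=
  \sum_i v i *: e i.

Lemma fcomb_is_linear n (V : lmodType R) (e : 'I_n -> V) : linear (fcomb e).
Proof.
move=> c u v; rewrite /fcomb scaler_sumr -big_split; apply: eq_bigr => i _ /=.
by rewrite !ffunE scalerDl scalerA.
Qed.
HB.instance Definition _ n (V : lmodType R) (e : 'I_n -> V) :=
  GRing.isLinear.Build R {ffun 'I_n -> R^o} V *:%R (fcomb e) (fcomb_is_linear e).

Variables (d : nat) (y : 'I_d -> R).

Definition koszul_exact (M : lmodType R) := forall i (x : koszul d M i.+1),
  koszul_diff y x = 0 -> exists w : koszul d M i.+2, x = koszul_diff y w.

Lemma koszul_exact_free n : koszul_exact R^o -> koszul_exact {ffun 'I_n -> R^o}.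
Proof.
move=> Rex i x dx0.
have /choice[w xw] (l : 'I_n) : exists w : koszul d R^o i.+2,
    kmap (fcoord l) x = koszul_diff y w.
  by apply: Rex; rewrite kmap_diff dx0 linear0.
pose W : koszul d {ffun 'I_n -> R^o} i.+2 := [ffun S => [ffun l => w l S]].
have Ww l : kmap (fcoord l) W = w l.
  by apply/ffunP => S; rewrite !ffunE /fcoord ffunE.
exists W; apply/ffunP => S; apply/ffunP => l.
have := congr1 (fun u => fun_of_fin u S) (xw l).
by rewrite -Ww kmap_diff /= !ffunE.
Qed.

(** An exact sequence 0 -> A -> R^n -> C -> 0. Its second map is given by the images
    e_i of the basis, since these are what the Frobenius functor transforms. *)
Definition syzygy (A C : lmodType R) n :=
  exists (f : {linear A -> {ffun 'I_n -> R^o}}) (e : 'I_n -> C),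
  [/\ injective f, (forall c, exists v, fcomb e v = c) &
      forall v, fcomb e v = 0 <-> exists a, v = f a].

End FreeModules.

Section Dependence.
Variables (k : fieldType) (R : comAlgType k) (d : nat) (y : 'I_d -> R).

(** The bound dim_k H_i(y; M) <= b, stated through relations so that it can be
    transported along connecting maps and direct limits. *)
Definition koszul_dep (M : lmodType R) i b :=
  forall z : 'I_b.+1 -> koszul d M i, (forall l, koszul_diff y (z l) = 0) ->
  exists2 c : 'I_b.+1 -> k, (exists l, c l != 0) &
    exists x : koszul d M i.+1,
      \sum_l ((c l)%:A : R) *: z l = koszul_diff y x.

(** The connecting map H_(i+1)(C) -> H_i(A) is injective because H_(i+1)(R^n) = 0:
    lift the cycles z_l to w_l over R^n, pull the boundaries of the w_l back to
    cycles u_l over A, and transport a relation between the u_l to the z_l. *)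
Lemma koszul_dep_syzygy (A C : lmodType R) n i b :
  koszul_exact y R^o -> syzygy A C n -> koszul_dep A i b ->
  koszul_dep C i.+1 b.
Proof.
move=> Rex [f [e [finj gsurj fg]]] Adep z dz0.
pose g : {linear _ -> _} := fcomb e.
have /choice[w wz] l : exists w : koszul d {ffun 'I_n -> R^o} i.+1, kmap g w = z l.
  have /choice[w wz] S : exists v, g v = z l S by apply: gsurj.
  by exists [ffun S => w S]; apply/ffunP => S; rewrite !ffunE.
have /choice[u uw] l : exists u : koszul d A i, kmap f u = koszul_diff y (w l).
  have /choice[u uw] S : exists a, koszul_diff y (w l) S = f a.
    apply/fg; have := kmap_diff y g (w l); rewrite wz dz0.
    by move=> /(congr1 (fun u => fun_of_fin u S)); rewrite [in RHS]ffunE ffunE.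
  by exists [ffun S => u S]; apply/ffunP => S; rewrite [LHS]ffunE [in LHS]ffunE -uw.
have du0 l : koszul_diff y (u l) = 0.
  apply/ffunP => S; apply: finj; rewrite [in RHS]ffunE linear0.
  have := kmap_diff y f (u l); rewrite uw (koszul_diffK y (w l)).
  by move=> /(congr1 (fun u => fun_of_fin u S)); rewrite [in RHS]ffunE ffunE.
have [c cn0 [x xE]] := Adep u du0; exists c => //.
have : koszul_diff y (\sum_l ((c l)%:A : R) *: w l - kmap f x) = 0.
  rewrite linearB /= kmap_diff -xE !linear_sum -big_split big1// => l _.
  by rewrite /= !linearZ /= uw scalerN subrr.
case/(koszul_exact_free Rex) => v vE; exists (kmap g v).
rewrite kmap_diff -vE linearB /= linear_sum [X in _ - X](_ : _ = 0) ?subr0.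
  by apply: eq_bigr => l _; rewrite linearZ /= wz.
apply/ffunP => S; rewrite !ffunE; apply/fg; by exists (x S).
Qed.

(** Modulo (y) the generators span M over k, so b + 1 elements of M are dependent
    modulo (y) M, the module of 0-boundaries. *)
Lemma koszul_dep0 (M : lmodType R) b (e : 'I_b -> M) :
  (forall r : R, exists (c : k) (s : 'I_d -> R), r = c%:A + \sum_j s j * y j) ->
  (forall x, exists c : 'I_b -> R, x = \sum_i c i *: e i) ->
  koszul_dep M 0 b.
Proof.
move=> res gen z _.
have S0 : #|set0 : {set 'I_d}| == 0%N by rewrite cards0.
pose o : {S : {set 'I_d} | #|S| == 0%N} := Sub set0 S0.
have /choice[r rE] l : exists r : 'I_b -> R, z l o = \sum_i r i *: e i by apply: gen.
have /choice[m mE] (li : 'I_b.+1 * 'I_b) :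
    exists m : k * ('I_d -> R), r li.1 li.2 = m.1%:A + \sum_j m.2 j * y j.
  by have [c [s ->]] := res (r li.1 li.2); exists (c, s).
(* The relation is a row vector killed by the constant parts of the coordinates. *)
pose B : 'M[k]_(b.+1, b) := \matrix_(l, i) (m (l, i)).1.
have : kermx B != 0.
  rewrite kermx_eq0 -row_leq_rank -ltnNge.
  by apply: leq_trans (rank_leq_col B) _.
case/rowV0Pn=> c /sub_kermxP cB c0.
exists (fun l => c 0 l); first by apply/rV0Pn.
pose h j := \sum_i (\sum_l (c 0 l)%:A * (m (l, i)).2 j) *: e i.
pose x := kchain 1 (fun S : {set 'I_d} => if set_min S is Some j then h j else 0).
exists x; apply/ffunP => S.
have SE : S = o by apply/val_inj/eqP; rewrite /= -cards_eq0 (valP S).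
rewrite {}SE (koszul_diffE y x o) /kdiff [val o]/= sum_ffunE.
have -> : \sum_(j | j \notin (set0 : {set 'I_d}))
   ((-1) ^+ ksign set0 j * y j) *: kcoef x (j |: set0) = \sum_j y j *: h j.
  apply: eq_big => [j|j _]; first by rewrite inE.
  rewrite setU0 kcoef_chain ?cards1// (@set_minP _ _ j) ?set11//; last first.
    by move=> t; rewrite inE => /eqP ->.
  rewrite (_ : ksign _ _ = 0%N) ?expr0 ?mul1r//.
  by apply: eq_card0 => t; rewrite !inE.
under eq_bigr do rewrite ffunE rE scaler_sumr.
under [RHS]eq_bigr do rewrite scaler_sumr.
rewrite exchange_big [RHS]exchange_big /=; apply: eq_bigr => i _.
under eq_bigr do rewrite scalerA.
under [RHS]eq_bigr do rewrite scalerA.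
rewrite -!scaler_suml; congr (_ *: _).
under eq_bigr => l _ do rewrite (mE (l, i)) mulrDr mulr_sumr.
rewrite big_split /= [X in X + _](_ : _ = 0) ?add0r.
  rewrite exchange_big; apply: eq_bigr => j _; rewrite mulr_sumr.
  by apply: eq_bigr => l _; rewrite mulrA mulrC.
transitivity ((\sum_l c 0 l * (m (l, i)).1)%:A : R).
  by rewrite scaler_suml; apply: eq_bigr => l _; rewrite -scalerAl mul1r scalerA.
have /rowP/(_ i) := cB; rewrite mxE [RHS]mxE => cBi.
have -> : \sum_l c 0 l * (m (l, i)).1 = 0.
  by rewrite -[RHS]cBi; apply: eq_bigr => l _; rewrite mxE.
exact: scale0r.
Qed.

End Dependence.

(** * From dependence to finite dimension *)

Section FiniteDimension.
Variables (k : fieldType) (V : lmodType k).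

Definition independent n (v : 'I_n -> V) :=
  forall c : 'I_n -> k, \sum_i c i *: v i = 0 -> forall i, c i = 0.

(** An independent family that cannot be made longer by one vector is a basis. *)
Lemma vector_axiom_of_dep b :
  (forall v : 'I_b.+1 -> V, ~ independent v) ->
  exists n, inhabited (Vector.axiom n V).
Proof.
move=> dep.
have bP : exists n, `[< ~ exists v : 'I_n.+1 -> V, independent v >].
  by exists b; apply/asboolP => -[v] /(dep v).
case: (ex_minnP bP) => n /asboolP nP nmin.
have [v vind] : exists v : 'I_n -> V, independent v.
  case: n nP nmin => [|n] nP nmin; first by exists (fun=> 0) => c _ [].
  apply: contrapT => nv; have := nmin n; rewrite ltnn => H.
  by apply/notF/H/asboolP.
exists n.
have /choice[g gE] x : exists c : 'rV[k]_n, x = \sum_i c 0 i *: v i.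
  pose w (i : 'I_n.+1) := if unlift ord0 i is Some j then v j else x.
  have : ~ independent w by move=> ?; apply: nP; exists w.
  move=> /existsNP[c] /not_implyP[]; rewrite big_ord_recl /w unlift_none.
  under eq_bigr do rewrite liftK.
  move=> cE.
  move=> /existsNP[i0 ci0].
  have c0 : c ord0 != 0.
    apply/eqP => c0; move: cE; rewrite c0 scale0r add0r => /vind cv.
    by apply: ci0; case: (unliftP ord0 i0) => [j|] ->; rewrite ?c0 ?cv.
  exists (\row_i (- (c ord0)^-1 * c (fintype.lift ord0 i))).
  under eq_bigr do rewrite mxE -scalerA.
  rewrite -scaler_sumr; move/eqP: cE; rewrite addrC addr_eq0 => /eqP ->.
  by rewrite scaleNr scalerN opprK scalerA mulVf// scale1r.
have vinj (a c : 'rV[k]_n) : \sum_i a 0 i *: v i = \sum_i c 0 i *: v i -> a = c.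
  move=> /eqP; rewrite -subr_eq0 -sumrB => /eqP ac; apply/rowP => i; apply/eqP.
  rewrite -subr_eq0; apply/eqP; apply: (vind (fun i => a 0 i - c 0 i)).
  by rewrite -[RHS]ac; apply: eq_bigr => j _; rewrite scalerBl.
constructor; exists g.
  move=> a x z; apply: vinj; rewrite -gE {1}(gE x) {1}(gE z) scaler_sumr -big_split.
  by apply: eq_bigr => i _; rewrite !mxE scalerDl scalerA.
exists (fun c : 'rV[k]_n => \sum_i c 0 i *: v i) => [x|c]; first by rewrite -gE.
by apply: vinj; rewrite -gE.
Qed.

End FiniteDimension.

Lemma fin_dim_koszul_homology (k : fieldType) (R : comAlgType k) (d : nat)
    (y : 'I_d -> R) (M : lmodType R) i b :
  koszul_dep y M i b -> fin_dim (koszul_homology y M i).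
Proof.
move=> dep; apply: (@vector_axiom_of_dep _ _ b) => v vind.
pose pi : {linear _ -> _} := quotmod_pi (@koszul_boundary R d y M i).
have /choice[z zE] l : exists z, pi z = v l.
  by exists (repr (v l)); apply: quotmod_reprK.
have [c [l cl0] [x xE]] := dep (fun l => val (z l)) (fun l => eqP (valP (z l))).
case/eqP: cl0; apply: vind.
transitivity (pi (\sum_l ((c l)%:A : R) *: z l)).
  rewrite linear_sum; apply: eq_bigr => j _.
  by rewrite linearZ /= zE.
rewrite -(linear0 pi); apply/quotmod_piP; rewrite subr0; apply: span_gen.
exists x; rewrite -xE linear_sum.
by apply: eq_bigr => j _; rewrite linearZ.
Qed.

(** * The Frobenius functor *)

Section FrobeniusFunctor.
Variables (p : nat) (R : comNzRingType).
Hypothesis charRp : p \in [pchar R].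

Section Tensor.
Variable M : lmodType R.

Definition ftens (m : M) : frobF p M := frob_tensor p 1 m.

Let pi : {linear _ -> _} := quotmod_pi (@frob_rel p R M).

Lemma frob_tensorE a m : frob_tensor p a m = a *: ftens m.
Proof.
rewrite -[a in LHS]mulr1 -(linearZ_LR pi).
exact/quotmod_piP/span_gen/frob_rel_left.
Qed.

Lemma ftensD : {morph ftens : m n / m + n}.
Proof.
move=> m n; rewrite -(linearD pi).
exact/quotmod_piP/span_gen/frob_rel_addr.
Qed.

Lemma ftensZ r m : ftens (r *: m) = r ^+ p *: ftens m.
Proof.
rewrite -frob_tensorE -[r ^+ p]mulr1; apply: esym.
exact/quotmod_piP/span_gen/frob_rel_mid.
Qed.

Lemma ftens0 : ftens 0 = 0.
Proof. by apply: (addrI (ftens 0)); rewrite -ftensD !addr0. Qed.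

Lemma ftens_sum n (F : 'I_n -> M) : ftens (\sum_i F i) = \sum_i ftens (F i).
Proof. by rewrite (big_morph _ ftensD ftens0). Qed.

Lemma frobF_ind (P : frobF p M -> Prop) :
  P 0 -> (forall a m u, P u -> P (a *: ftens m + u)) -> forall u, P u.
Proof.
move=> P0 PS u; have [D <-] : exists D, pi D = u.
  by exists (repr u); apply: quotmod_reprK.
rewrite -(freeg_sumE D); elim: (dom D) => [|x s IH].
  by rewrite big_nil linear0.
rewrite big_cons linearD.
have -> : << coeff x D *g x >> = coeff x D *: << x >> :> {freeg (R * M)%type / R}.
  by apply/eqP/freeg_eqP => z; rewrite coeffZ !coeffU mul1r.
case: x => a m; rewrite linearZ_LR -[pi _]/(frob_tensor p a m) frob_tensorE scalerA.
exact: PS.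
Qed.

Lemma frobF_gen n (e : 'I_n -> M) :
  (forall x, exists c : 'I_n -> R, x = \sum_i c i *: e i) ->
  forall u, exists c : 'I_n -> R, u = \sum_i c i *: ftens (e i).
Proof.
move=> gen; elim/frobF_ind => [|a m u [c ->]].
  by exists (fun=> 0); rewrite big1// => i _; rewrite scale0r.
have [b ->] := gen m; exists (fun i => a * b i ^+ p + c i).
rewrite ftens_sum scaler_sumr -big_split; apply: eq_bigr => i _ /=.
by rewrite ftensZ scalerA scalerDl.
Qed.

(** The universal property of R' (x)_R M: its R-linear maps are the p-linear maps
    from M. *)
Lemma frobF_lift (W : lmodType R) (f : M -> W) :
  {morph f : m n / m + n} -> (forall r m, f (r *: m) = r ^+ p *: f m) ->
  exists h : {linear frobF p M -> W}, forall m, h (ftens m) = f m.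
Proof.
move=> fD fZ; pose F (x : R * M) := x.1 *: f x.2.
pose h : {linear _ -> _} := fglift F.
have h1 x : h << x >> = F x by rewrite [LHS]liftU scale1r.
have hrel v : frob_rel p v -> h v = 0.
  case=> [a b m|a m n|a r m|r a m]; rewrite (linearB h) !h1;
    apply/eqP; rewrite subr_eq0; apply/eqP.
  - by rewrite (linearD h) !h1 /F /= scalerDl.
  - by rewrite (linearD h) !h1 /F /= fD scalerDr.
  - by rewrite /F /= fZ scalerA mulrC.
  by rewrite (linearZ_LR h) /= h1 /F /= scalerA.
exists (quotmod_lift hrel) => m.
by rewrite [LHS]quotmod_liftE h1 /F scale1r.
Qed.

End Tensor.

(** The equational criterion of flatness for the Frobenius endomorphism: relations
    with p-th powers as coefficients come from relations over R. *)
Definition frob_flat := forall n r (g : 'I_r -> {ffun 'I_n -> R^o}) (b : 'I_r -> R),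
  (forall l, \sum_i b i * (g i l : R) ^+ p = 0) ->
  exists (T : finType) (c : T -> R) (z : T -> 'I_r -> R),
    (forall t, \sum_i z t i *: g i = 0) /\
    (forall i, b i = \sum_t c t * z t i ^+ p).

Definition fpow n (v : {ffun 'I_n -> R^o}) : {ffun 'I_n -> R^o} :=
  [ffun l => (v l : R) ^+ p].

(** The new map F(A) -> R^n is induced by the coordinatewise p-th power of A -> R^n,
    and the new generators of F(C) are the 1 (x) e_i. Flatness is needed for the
    injectivity; exactness in the middle is the right exactness of F, proved by
    constructing the inverse F(C) -> R^n / im F(A). *)
Lemma syzygy_frobF (A C : lmodType R) n :
  frob_flat -> fin_gen A -> syzygy A C n ->
  syzygy (frobF p A) (frobF p C) n.
Proof.
move=> flat [r [a agen]] [f [e [finj gsurj fg]]].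
have fpowD : {morph @fpow n : u v / u + v}.
  by move=> u v; apply/ffunP => l; rewrite !ffunE (powpD charRp).
have fpowZ c v : @fpow n (c *: v) = c ^+ p *: fpow v.
  by apply/ffunP => l; rewrite !ffunE [(_ : R) ^+ p]exprMn.
have [f' f'E] : exists f' : {linear frobF p A -> {ffun 'I_n -> R^o}},
    forall m, f' (ftens m) = fpow (f m).
  apply: frobF_lift => [u v|c u]; first by rewrite linearD fpowD.
  by rewrite linearZ fpowZ.
pose g : {linear _ -> _} := fcomb e.
pose e' i := ftens (e i); pose g' : {linear _ -> _} := fcomb e'.
have g'pow v : g' (fpow v) = ftens (g v).
  rewrite /= /g /fcomb ftens_sum; apply: eq_bigr => i _.
  by rewrite ffunE ftensZ.
exists f', e'; split.
- suff inj0 u : f' u = 0 -> u = 0 by apply: raddf_inj.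
  have [b ->] := frobF_gen agen u => fu0.
  have [|T [c [z [zsyz bE]]]] := flat _ _ (fun i => f (a i)) b.
    move=> l; move: fu0; rewrite linear_sum => /ffunP/(_ l).
    rewrite sum_ffunE [RHS]ffunE => fu0; rewrite -[RHS]fu0.
    by apply: eq_bigr => i _; rewrite linearZ /= f'E !ffunE.
  rewrite (eq_bigr (fun i => \sum_t c t *: ftens (z t i *: a i))) => [|i _]; last first.
    by rewrite bE scaler_suml; apply: eq_bigr => t _; rewrite ftensZ scalerA.
  rewrite exchange_big big1 //= => t _; rewrite -scaler_sumr -ftens_sum.
  rewrite (_ : \sum_i _ = 0) ?ftens0 ?scaler0//; apply: finj.
  rewrite linear_sum linear0 -[RHS](zsyz t).
  by apply: eq_bigr => i _; rewrite linearZ.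
- move=> u.
  have [|c ->] := frobF_gen (e := e) _ u; last first.
    by exists [ffun i => c i]; apply: eq_bigr => i _; rewrite ffunE.
  move=> x; have [v <-] := gsurj x; by exists v.
move=> v; split=> [gv0|[u ->]]; last first.
  rewrite -[fcomb e' _]/(g' _); elim/frobF_ind: u => [|b m u IH].
    by rewrite !linear0.
  rewrite !linearP IH f'E g'pow addr0 (_ : g _ = 0) ?ftens0 ?scaler0//.
  by apply/fg; exists m.
pose im w := exists u, w = f' u.
have im_sub : submodule im.
  split=> [|c w w' [u ->] [u' ->]]; first by exists 0; rewrite linear0.
  by exists (c *: u + u'); rewrite linearP.
pose q : {linear _ -> _} := quotmod_pi im.
have q0 w : q w = 0 -> im w.
  rewrite -(linear0 q) => /quotmod_piP; rewrite subr0 => /asboolP.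
  exact: (spanned_min im_sub (fun _ => id)).
(* The p-th power modulo im F(A) depends only on the image in C. *)
have qpow u w : g u = g w -> q (fpow u) = q (fpow w).
  move=> guw; have : g (u - w) = 0 by rewrite linearB guw subrr.
  move/fg => [m mE]; rewrite -[u](subrK w) fpowD linearD mE.
  rewrite (_ : q (fpow (f m)) = 0) ?add0r// -(linear0 q).
  apply/quotmod_piP; rewrite subr0; apply: span_gen.
  by exists (ftens m); rewrite f'E.
have /choice[x xE] c : exists w, g w = c by apply: gsurj.
have [|c b|s sE] := @frobF_lift C _ (fun c => q (fpow (x c))).
- by move=> c b; rewrite -linearD -fpowD; apply: qpow; rewrite linearD !xE.
- by rewrite -linearZ -fpowZ; apply: qpow; rewrite linearZ /= !xE.
apply: q0; rewrite -(linear0 s) -gv0 [in RHS]/fcomb linear_sum.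
have vE : v = \sum_i v i *: fpow [ffun l => (i == l)%:R].
  apply/ffunP => l; rewrite sum_ffunE (bigD1 l) //= big1 => [|i il].
    by rewrite !ffunE eqxx expr1n addr0 [_ *: _]mulr1.
  rewrite !ffunE (negbTE il) expr0n.
  by rewrite -[p]prednK ?(pchar_gt0 charRp)// [_ *: _]mulr0.
rewrite {1}vE linear_sum; apply: eq_bigr => i _; rewrite !linearZ /= sE.
congr (_ *: _); apply: qpow.
rewrite xE /= /g /fcomb (bigD1 i) //= big1 => [|l li].
  by rewrite ffunE eqxx scale1r addr0.
by rewrite ffunE eq_sym (negbTE li) scale0r.
Qed.

Lemma fin_gen_frobF (M : lmodType R) : fin_gen M -> fin_gen (frobF p M).
Proof. by move=> [n [e /frobF_gen gen]]; exists n, (fun i => ftens (e i)). Qed.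

End FrobeniusFunctor.

(** * Direct limits of sequences of modules *)

Section ProductModule.
Variables (R : comNzRingType) (V : nat -> lmodType R).

Definition seqprod : Type := forall i, V i.
HB.instance Definition _ := gen_eqMixin seqprod.
HB.instance Definition _ := gen_choiceMixin seqprod.

Implicit Types (s t u : seqprod).
Let sadd s t : seqprod := fun i => s i + t i.
Let sopp s : seqprod := fun i => - s i.
Let szero : seqprod := fun i => 0.
Let sscale (c : R) s : seqprod := fun i => c *: s i.

Let saddA : associative sadd.
Proof.
by move=> s t u; apply: functional_extensionality_dep => i;
  rewrite /sadd addrA. Qed.
Let saddC : commutative sadd.
Proof.
by move=> s t; apply: functional_extensionality_dep => i;
  rewrite /sadd addrC. Qed.
Let sadd0 : left_id szero sadd.
Proof.
by move=> s; apply: functional_extensionality_dep => i;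
  rewrite /sadd add0r. Qed.
Let saddN : left_inverse szero sopp sadd.
Proof.
by move=> s; apply: functional_extensionality_dep => i;
  rewrite /sadd addNr. Qed.
HB.instance Definition _ := GRing.isZmodule.Build seqprod saddA saddC sadd0 saddN.

Let sscaleA a b s : sscale a (sscale b s) = sscale (a * b) s.
Proof. by apply: functional_extensionality_dep => i; rewrite /sscale scalerA. Qed.
Let sscale1 : left_id 1 sscale.
Proof.
by move=> s; apply: functional_extensionality_dep => i;
  rewrite /sscale scale1r. Qed.
Let sscaleDr : right_distributive sscale +%R.
Proof.
by move=> c s t; apply: functional_extensionality_dep => i;
  rewrite /sscale scalerDr. Qed.
Let sscaleDl s : {morph sscale^~ s : a b / a + b}.
Proof.
by move=> a b; apply: functional_extensionality_dep => i;
  rewrite /sscale scalerDl. Qed.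
HB.instance Definition _ := GRing.Zmodule_isLmodule.Build R seqprod
  sscaleA sscale1 sscaleDr sscaleDl.

Lemma seqprodE c s t i : (c *: s + t) i = c *: s i + t i.
Proof. by []. Qed.

End ProductModule.

Section DirectLimit.
Variables (R : comNzRingType) (V : nat -> lmodType R).
Variable t : forall j, {linear V j -> V j.+1}.

(** The image of v at stage i; it is meaningful for j <= i, and 0 before stage j. *)
Fixpoint transit j (v : V j) (i : nat) : V i :=
  match @eqP _ j i with
  | ReflectT e => ecast m (V m) e v
  | ReflectF _ => match i return V i with 0 => 0 | i'.+1 => t i' (transit v i') end
  end.

Lemma transit_id j (v : V j) : transit v j = v.
Proof. by case: j v => [|j] v /=; case: eqP => // e; rewrite (eq_irrelevance e erefl). Qed.

Lemma transitS j (v : V j) i : j != i.+1 -> transit v i.+1 = t i (transit v i).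
Proof. by move=> /=; case: eqP. Qed.

Lemma transit_is_linear j i : linear (fun v : V j => transit v i).
Proof.
move=> c u v; elim: i => [|i IH] /=; case: eqP => [e|_].
- by case: _ / e => /=.
- by rewrite scaler0 addr0.
- by case: _ / e => /=.
by rewrite -linearP -IH.
Qed.

Definition trans j i (v : V j) := transit v i.
HB.instance Definition _ j i := GRing.isLinear.Build R (V j) (V i) *:%R
  (@trans j i) (@transit_is_linear j i).

Lemma transit_t j (v : V j) i : (j < i)%N -> transit (t j v) i = transit v i.
Proof.
elim: i => // i IH; rewrite ltnS leq_eqVlt => /predU1P[ji|ji].
  by subst i; rewrite transit_id transitS ?ltn_eqF// transit_id.
by rewrite !transitS ?IH// ltn_eqF// ltnS// ltnW.
Qed.

Variables (L : lmodType R) (phi : forall j, {linear V j -> L}).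
Hypothesis Llim : is_direct_limit t phi.

Lemma phi_transit j (v : V j) i : (j <= i)%N -> phi i (transit v i) = phi j v.
Proof.
elim: i => [|i IH]; first by rewrite leqn0 => /eqP j0; subst j; rewrite transit_id.
rewrite leq_eqVlt => /predU1P[ji|ji]; first by subst j; rewrite transit_id.
by rewrite transitS ?ltn_eqF// (Llim.1) IH.
Qed.

(** The quotient of L by the images of the stages receives the zero map and the
    projection, which agree on all stages; by uniqueness they are equal. *)
Lemma limit_stage (x : L) : exists j v, phi j v = x.
Proof.
pose im (x : L) := exists j v, phi j v = x.
have im_sub : submodule im.
  split=> [|c u v [j [a <-]] [i [b <-]]]; first by exists 0%N, 0; rewrite linear0.
  exists (maxn j i), (c *: transit a _ + transit b _).
  by rewrite linearP !phi_transit ?leq_maxl ?leq_maxr.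
pose q : {linear _ -> _} := quotmod_pi im.
have q0 j (v : V j) : q (phi j v) = 0.
  rewrite -(linear0 q); apply/quotmod_piP; rewrite subr0; apply: span_gen.
  by exists j, v.
have [//|h _ huniq] := Llim.2 _ (fun j => (\0 : {linear V j -> quotmod im})%R).
have qh := huniq q q0; have zh := huniq \0 (fun _ _ => erefl).
have : q x = q 0 by rewrite qh -zh linear0.
move=> /quotmod_piP; rewrite subr0 => /asboolP.
exact: (spanned_min im_sub (fun _ => id)).
Qed.

(** The stages also map to the sequences modulo eventually zero ones, v going to
    its images at all later stages; there an element dies only if it dies at a
    later stage. *)
Lemma limit_zero j (v : V j) : phi j v = 0 ->
  exists N, forall i, (N <= i)%N -> transit v i = 0.
Proof.
pose ez (s : seqprod V) := exists N, forall i, (N <= i)%N -> s i = 0.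
have ez_sub : submodule ez.
  split=> [|c u w [N uN] [N' wN]]; first by exists 0%N.
  exists (maxn N N') => i; rewrite geq_max => /andP[Ni Ni'].
  by rewrite seqprodE uN// wN// scaler0 addr0.
pose q : {linear _ -> _} := quotmod_pi ez.
pose G j (v : V j) : quotmod ez := q (fun i => transit v i).
have Glin j' : linear (@G j').
  move=> c u w; rewrite /G -linearP; congr (q _).
  by apply: functional_extensionality_dep => i; apply: transit_is_linear.
pose GL j' : {linear V j' -> quotmod ez} :=
  HB.pack (@G j') (GRing.isLinear.Build R (V j') (quotmod ez) *:%R _ (Glin j')).
have [j' u|h hG _] := Llim.2 _ GL.
  apply/quotmod_piP/span_gen; exists j'.+1 => i ji.
  change (transit (t j' u) i - transit u i = 0).
  by rewrite transit_t// subrr.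
move=> v0; have := hG j v; rewrite v0 linear0 => /esym.
rewrite -[X in _ = X](linear0 q) => /quotmod_piP.
by rewrite subr0 => /asboolP/(spanned_min ez_sub (fun _ => id)).
Qed.

Lemma limit_stage_fin (T : finType) (x : T -> L) :
  exists j (v : T -> V j), forall s, phi j (v s) = x s.
Proof.
have /choice[jv jvE] s : exists jv : {j & V j}, phi _ (tagged jv) = x s.
  by have [j [v <-]] := limit_stage (x s); exists (Tagged V v).
exists (\max_s tag (jv s)), (fun s => transit (tagged (jv s)) _) => s.
by rewrite phi_transit// (leq_bigmax s).
Qed.

Lemma limit_zero_fin (T : finType) j (v : T -> V j) : (forall s, phi j (v s) = 0) ->
  exists2 N, (j <= N)%N & forall s, transit (v s) N = 0.
Proof.
move=> v0; have /choice[N NE] s := limit_zero (v0 s).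
exists (maxn j (\max_s N s)); first exact: leq_maxl.
by move=> s; apply: NE; rewrite leq_max (leq_bigmax s) orbT.
Qed.

End DirectLimit.

(** * Noetherian rings with flat Frobenius *)

Section FlatFrobenius.
Variables (k : fieldType) (R : comAlgType k) (d : nat) (y : 'I_d -> R).

(** Finitely many cycles lift to cycles of some stage; a relation there maps to a
    relation in the limit. *)
Lemma koszul_dep_limit (V : nat -> lmodType R)
    (t : forall j, {linear V j -> V j.+1}) (L : lmodType R)
    (phi : forall j, {linear V j -> L}) i b :
  is_direct_limit t phi -> (forall j, koszul_dep y (V j) i b) ->
  koszul_dep y L i b.
Proof.
move=> Llim Vdep z dz0.
have [j [v vE]] := limit_stage_fin Llim
  (fun ls : 'I_b.+1 * {S : {set 'I_d} | #|S| == i} => z ls.1 ls.2).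
pose w l : koszul d (V j) i := [ffun S => v (l, S)].
have wz l : kmap (phi j) (w l) = z l by apply/ffunP => S; rewrite !ffunE vE.
have [ls|N jN NE] := limit_zero_fin Llim
  (v := fun ls : 'I_b.+1 * {S : {set 'I_d} | #|S| == i.-1} =>
          koszul_diff y (w ls.1) ls.2).
  have := kmap_diff y (phi j) (w ls.1); rewrite wz dz0.
  by move=> /(congr1 (fun u => fun_of_fin u ls.2)); rewrite [LHS]ffunE [RHS]ffunE.
pose w' l : koszul d (V N) i := kmap (trans t N) (w l).
have [l|c c0 [x xE]] := Vdep N w'.
  rewrite kmap_diff; apply/ffunP => S; rewrite [LHS]ffunE [RHS]ffunE.
  exact: (NE (l, S)).
exists c => //; exists (kmap (phi N) x).
rewrite kmap_diff -xE linear_sum; apply: eq_bigr => l _.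
rewrite linearZ /= -wz; congr (_ *: _); apply/ffunP => S.
by rewrite !ffunE (phi_transit Llim).
Qed.

Definition noetherian_free (A : comNzRingType) :=
  forall n (Z : {ffun 'I_n -> A^o} -> Prop), submodule Z ->
  exists (T : finType) (g : T -> {ffun 'I_n -> A^o}), (forall i, Z (g i)) /\
    forall z, Z z -> exists c : T -> A, z = \sum_i c i *: g i.

Variable p : nat.
Hypotheses (charRp : p \in [pchar R]) (noeth : noetherian_free R)
  (flat : frob_flat p R) (yexact : koszul_exact y R^o)
  (residue : forall r : R,
     exists (c : k) (s : 'I_d -> R), r = c%:A + \sum_j s j * y j).

Lemma syzygy_exists (M : lmodType R) : fin_gen M ->
  exists (A : lmodType R) n, fin_gen A /\ syzygy A M n.
Proof.
move=> [n [e gen]]; pose g : {linear _ -> _} := fcomb e.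
exists (lkernel g), n; split.
  have [|T [a [az agen]]] := @noeth n (fun v => g v = 0).
    split=> [|c u v u0 v0]; first exact: linear0.
    by rewrite linearP u0 v0 scaler0 addr0.
  have ak i : a i \in ker_pred g by apply/eqP/az.
  exists #|T|, (fun i => Sub (a (enum_val i)) (ak _)) => x.
  have [c cE] := agen (val x) (eqP (valP x)); exists (fun i => c (enum_val i)).
  apply: val_inj; rewrite cE linear_sum (reindex _ (onW_bij _ (enum_val_bij T))).
  by apply: eq_bigr => i _; rewrite linearZ.
exists val, e; split; first exact: val_inj.
  move=> x; have [c ->] := gen x; exists [ffun i => c i].
  by apply: eq_bigr => i _; rewrite ffunE.
move=> v; split=> [v0|[a ->]]; last exact/eqP/(valP a).
have vk : v \in ker_pred g by apply/eqP.
by exists (Sub v vk).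
Qed.

(** The bound is the rank of the i-th term of a free resolution of M: F preserves
    both the number of generators and the presentations. *)
Lemma koszul_dep_frobF_iter i (M : lmodType R) : fin_gen M ->
  exists b, forall j, koszul_dep y (frobF_iter p M j) i b.
Proof.
elim: i M => [|i IH] M Mfg.
  have [n [e gen]] := Mfg; exists n => j.
  have [e' gen'] : exists e' : 'I_n -> frobF_iter p M j,
      forall x, exists c : 'I_n -> R, x = \sum_i c i *: e' i.
    elim: j => [|j [e' /(@frobF_gen p) gen']]; first by exists e.
    by exists (fun i => ftens p (e' i)).
  exact: (koszul_dep0 residue gen').
have [A [n [Afg Asyz]]] := syzygy_exists Mfg.
have [b Adep] := IH A Afg; exists b => j.
apply: (koszul_dep_syzygy (n := n) yexact _ (Adep j)).
elim: j {Adep} => [//|j Jsyz] /=; apply: syzygy_frobF => //.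
by elim: j {Jsyz} => [//|j] /=; apply: fin_gen_frobF.
Qed.

Theorem fin_dim_koszul_F_finite (L : F_module R p) i :
  F_finite L -> fin_dim (koszul_homology y L i).
Proof.
move=> [M [beta [phi [Mfg Llim _]]]].
have [b Mdep] := koszul_dep_frobF_iter i Mfg.
apply: fin_dim_koszul_homology; exact: koszul_dep_limit Llim Mdep.
Qed.

End FlatFrobenius.

(** * p^-1-linear functionals on a field *)

Section CartierField.
Variables (p : nat) (k : fieldType).
Hypothesis charkp : p \in [pchar k].

Let FrD := powpD charkp.
Let FrB := powpB charkp.
Let p_gt0 := pchar_gt0 charkp.

(** Linear for the action of k on the source through p-th powers. *)
Definition pinv_linear (lam : {additive k -> k}) :=
  forall c x, lam (c ^+ p * x) = c * lam x.

(** A vector subspace of k over its subfield of p-th powers. *)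
Definition psubspace (U : k -> Prop) :=
  U 0 /\ forall c u v, U u -> U v -> U (c ^+ p * u + v).

Lemma psubspaceB U u v : psubspace U -> U u -> U v -> U (u - v).
Proof.
move=> [U0 US] Uu Uv; have := US (-1) v u Uv Uu.
by rewrite addrC -[-1]sub0r FrB expr1n expr0n gtn_eqF// sub0r mulN1r.
Qed.

Lemma psubspaceZ U c u : psubspace U -> U u -> U (c ^+ p * u).
Proof. by move=> [U0 US] Uu; have := US c u 0 Uu U0; rewrite addr0. Qed.

(** M is a maximal subspace containing U and avoiding x0. Enlarging M by a vector y
    outside it captures x0, and solving for y shows that M and x0 span k. *)
Lemma psubspace_maximal (U : k -> Prop) (x0 : k) : psubspace U -> ~ U x0 ->
  exists M : k -> Prop, [/\ psubspace M, (forall u, U u -> M u), ~ M x0 &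
    forall y, exists a, M (y - a ^+ p * x0)].
Proof.
move=> Usub Ux0.
(* The union with U keeps the condition true of the union of the empty chain. *)
pose P (W : set k) := psubspace (fun x => W x \/ U x) /\ ~ W x0.
have [|A [[Asub Ax0] Amax]] := @Zorn_bigcup k P.
  move=> F FP Ftot; split; last by case=> W /FP[_ Wx0] /Wx0.
  split=> [|c u v]; first by right; case: Usub.
  have one W x z : F W -> W x \/ U x -> W z \/ U z ->
      (\bigcup_(X in F) X)%classic (c ^+ p * x + z) \/ U (c ^+ p * x + z).
    move=> FW Wx Wz; have [[_ WS] _] := FP W FW.
    by case: (WS c x z Wx Wz) => [Wxz|]; [left; exists W|right].
  move=> [[W1 F1 u1]|Uu] [[W2 F2 v2]|Uv].
  - case: (Ftot _ _ F1 F2) => W12.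
      by apply: (one W2) => //; left=> //; apply: W12.
    by apply: (one W1) => //; left=> //; apply: W12.
  - by apply: (one W1) => //; [left|right].
  - by apply: (one W2) => //; [right|left].
  by right; case: Usub => _; apply.
pose M x := A x \/ U x.
have Mx0 : ~ M x0 by case.
exists M; split=> // [u Uu|y]; first by right.
have [My|NMy] := pselect (M y).
  by exists 0; rewrite expr0n gtn_eqF// mul0r subr0.
pose B (x : k) := exists w c, M w /\ x = w + c ^+ p * y.
have MB u : M u -> B u.
  by exists u, 0; rewrite expr0n gtn_eqF// mul0r addr0.
have Bsub : psubspace B.
  split=> [|c u v [w [a [Mw ->]]] [w' [a' [Mw' ->]]]]; first by apply: MB; case: Asub.
  exists (c ^+ p * w + w'), (c * a + a'); split; first by case: Asub => _; apply.
  by rewrite FrD exprMn; ring.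
have BP : ~ P B.
  apply: Amax; split=> [x Ax|BA]; first by apply: MB; left.
  apply: NMy; left; apply: BA; exists 0, 1; split; first by case: Asub.
  by rewrite expr1n mul1r add0r.
have Bx0 : B x0.
  apply: contrapT => NBx0; apply: BP; split=> //; split=> [|c u v Bu Bv].
    by left; case: Bsub.
  left; case: Bsub => _; apply.
    by case: Bu => // Uu; apply: MB; right.
  by case: Bv => // Uv; apply: MB; right.
have [w [c [Mw x0E]]] := Bx0.
have c0 : c != 0.
  apply/eqP => c0; apply: Mx0; rewrite x0E c0 expr0n gtn_eqF// mul0r addr0.
  exact: Mw.
have cp0 : c ^+ p != 0 by rewrite expf_neq0.
exists c^-1; have -> : y - c^-1 ^+ p * x0 = 0 - c^-1 ^+ p * w.
  by rewrite x0E exprVn mulrDr mulKf// opprD [- _ - y]addrC addrA subrr.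
apply: psubspaceB => //; first by case: Asub.
exact: psubspaceZ.
Qed.

Lemma pinv_linear_separate (U : k -> Prop) (x0 : k) : psubspace U -> ~ U x0 ->
  exists lam : {additive k -> k},
    [/\ pinv_linear lam, forall u, U u -> lam u = 0 & lam x0 = 1].
Proof.
move=> Usub Ux0.
have [M [Msub UM Mx0 Mdec]] := psubspace_maximal Usub Ux0.
have Muniq y a b : M (y - a ^+ p * x0) -> M (y - b ^+ p * x0) -> a = b.
  move=> Ma Mb; apply: contrapT => ab; apply: Mx0.
  have ab0 : a - b != 0 by rewrite subr_eq0; apply/eqP.
  have := psubspaceB Msub Mb Ma.
  have -> : y - b ^+ p * x0 - (y - a ^+ p * x0) = (a - b) ^+ p * x0.
    by rewrite FrB; ring.
  move=> /(psubspaceZ (a - b)^-1 Msub).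
  by rewrite mulrA -exprMn mulVf// expr1n mul1r.
have /choice[lam lamE] := Mdec.
have lamB : zmod_morphism lam.
  move=> y z; apply: (Muniq (y - z)) => //; rewrite FrB.
  have := psubspaceB Msub (lamE y) (lamE z).
  by congr M; ring.
pose lam' : {additive k -> k} := HB.pack lam (GRing.isZmodMorphism.Build k k lam lamB).
exists lam'; split=> [c x|u Uu|]; apply: Muniq (lamE _) _.
- by have := psubspaceZ c Msub (lamE x); rewrite exprMn; congr M; ring.
- by rewrite expr0n gtn_eqF// mul0r subr0; apply: UM.
by rewrite expr1n mul1r subrr; case: Msub.
Qed.

Definition pinv_functional := {lam : {additive k -> k} | pinv_linear lam}.

(** The elements x that satisfy the equation form a subspace of k, which is enlarged
    to contain the elements of X one at a time: for x0 outside it, a functional lam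
    that vanishes on it and takes the value 1 at x0 corrects the defect at x0. *)
Lemma pinv_dual_basis (X : seq k) : exists s : seq (k * pinv_functional),
  forall x, x \in X -> \sum_(z <- s) z.1 * (sval z.2 x) ^+ p = x.
Proof.
elim: X => [|x0 X [s sX]]; first by exists [::].
pose P x := \sum_(z <- s) z.1 * (sval z.2 x) ^+ p.
pose U x := P x = x.
have Usub : psubspace U.
  rewrite /U; split=> [|c u v Pu Pv].
    by rewrite /P big1// => z _; rewrite raddf0 expr0n gtn_eqF// mulr0.
  rewrite -{2}Pu -{2}Pv /P mulr_sumr -big_split; apply: eq_bigr => -[e [lam lamP]] _ /=.
  by rewrite raddfD lamP FrD exprMn; ring.
have [Ux0|NUx0] := pselect (U x0).
  by exists s => x; rewrite inE => /predU1P[->//|/sX].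
have [lam [lamP lamU lamx0]] := pinv_linear_separate Usub NUx0.
exists ((x0 - P x0, exist _ lam lamP : pinv_functional) :: s) => x.
rewrite inE big_cons /= -/(P x) => /predU1P[->|/sX Px].
  by rewrite lamx0 expr1n mulr1 subrK.
by rewrite lamU// expr0n gtn_eqF// mulr0 add0r.
Qed.

End CartierField.

(** * Algebras with monomials *)

(** What polynomials and power series have in common. The axiom [coef_op] says that
    coefficients may be altered one by one and moved to monomials of at most the same
    degree; a bound on the degrees of the monomials of a polynomial is preserved. *)
Record monomial_algebra (k : fieldType) (d : nat) (R : comAlgType k)
    (coef : R -> 'X_{1..d} -> k) (mon : 'X_{1..d} -> R) : Prop := MonomialAlgebra {
  coef_inj : forall f g, coef f =1 coef g -> f = g;
  coefP : forall c f g m, coef (c *: f + g) m = c * coef f m + coef g m;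
  coef_mon : forall u m, coef (mon u) m = (m == u)%:R;
  mon0 : mon 0%MM = 1;
  coefM : forall f g m, coef (f * g) m =
    \sum_(a : 'X_{1..d < (mdeg m).+1, (mdeg m).+1} | m == (a.1 + a.2)%MM)
      coef f a.1 * coef g a.2;
  coef_op : forall f (sig : 'X_{1..d} -> 'X_{1..d}) (tau : 'X_{1..d} -> k -> k),
    (forall m, (mdeg m <= mdeg (sig m))%N) -> (forall m, tau m 0 = 0) ->
    exists g, forall m, coef g m = tau m (coef f (sig m))
}.

Section MonomialAlgebraTheory.
Variables (k : fieldType) (d : nat) (R : comAlgType k).
Variables (coef : R -> 'X_{1..d} -> k) (mon : 'X_{1..d} -> R).
Hypothesis MA : monomial_algebra coef mon.
Implicit Types (f g h : R) (m u v w : 'X_{1..d}).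

Lemma coef_is_linear m : linear (fun f => coef f m : k^o).
Proof. by move=> c f g; apply: (coefP MA). Qed.

Definition coefl m f : k^o := coef f m.
HB.instance Definition _ m := GRing.isLinear.Build k R k^o *:%R (coefl m)
  (coef_is_linear m).

Lemma coef0 m : coef 0 m = 0. Proof. exact: (linear0 (coefl m)). Qed.
Lemma coefD f g m : coef (f + g) m = coef f m + coef g m.
Proof. exact: (linearD (coefl m)). Qed.
Lemma coefB f g m : coef (f - g) m = coef f m - coef g m.
Proof. exact: (linearB (coefl m)). Qed.
Lemma coefZ c f m : coef (c *: f) m = c * coef f m.
Proof. exact: (linearZ_LR (coefl m)). Qed.
Lemma coef_sum (I : Type) (r : seq I) (P : pred I) (F : I -> R) m :
  coef (\sum_(i <- r | P i) F i) m = \sum_(i <- r | P i) coef (F i) m.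
Proof. exact: (linear_sum (coefl m)). Qed.

Lemma coef_monM u f m :
  coef (mon u * f) m = if (u <= m)%MM then coef f (m - u)%MM else 0.
Proof.
rewrite (coefM MA); case: ifPn => [um|num].
  have ud : (mdeg u < (mdeg m).+1)%N by rewrite ltnS -(submK um) mdegD leq_addl.
  have md : (mdeg (m - u) < (mdeg m).+1)%N by rewrite ltnS mdegB.
  rewrite (bigD1 (BMultinom ud, BMultinom md)) /=; last by rewrite addmC submK.
  rewrite (coef_mon MA) eqxx mul1r big1 ?addr0// => -[a b] /= /andP[/eqP mab ne].
  rewrite (coef_mon MA); case: eqVneq => [au|]; last by rewrite mul0r.
  have aux (a' b' : 'X_{1..d}) : m = (a' + b')%MM -> a' = u -> b' = (m - u)%MM.
    by move=> -> ->; rewrite addmC addmK.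
  case/eqP: ne; congr (_, _); apply: val_inj => //=; exact: aux mab au.
apply: big1 => -[a b] /= /eqP mab; rewrite (coef_mon MA).
case: eqVneq => [au|]; last by rewrite mul0r.
by rewrite mab -au lem_addr in num.
Qed.

Lemma monM u v : mon u * mon v = mon (u + v)%MM.
Proof.
apply: (coef_inj MA) => m; rewrite coef_monM !(coef_mon MA).
case: ifP => [um|]; first by rewrite -(eqm_add2r u) submK// [(v + u)%MM]addmC.
by case: eqVneq => // ->; rewrite lem_addr.
Qed.

Lemma monX u n : mon u ^+ n = mon (u *+ n)%MM.
Proof.
elim: n => [|n IH]; first by rewrite expr0 mulm0n (mon0 MA).
by rewrite exprS IH monM mulmS.
Qed.

Lemma coef_const c m : coef (c%:A) m = if m == 0%MM then c else 0.
Proof.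
by rewrite coefZ -(mon0 MA) (coef_mon MA); case: eqP; rewrite ?mulr1 ?mulr0.
Qed.

Lemma operator (sig : 'X_{1..d} -> 'X_{1..d}) (tau : 'X_{1..d} -> {additive k -> k}) :
  (forall m, (mdeg m <= mdeg (sig m))%N) ->
  exists T : {additive R -> R}, forall f m, coef (T f) m = tau m (coef f (sig m)).
Proof.
move=> sigP; have /choice[T TE] f : exists g, forall m, coef g m = tau m (coef f (sig m)).
  have tau0 m : tau m 0 = 0 by rewrite raddf0.
  exact: (@coef_op _ _ _ _ _ MA f sig (fun m => tau m) sigP tau0).
have Tadd : zmod_morphism T.
  by move=> f g; apply: (coef_inj MA) => m; rewrite coefB !TE coefB raddfB.
pose T' : {additive R -> R} := HB.pack T (GRing.isZmodMorphism.Build R R T Tadd).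
by exists T'.
Qed.

Definition order_ge N f := forall m, (mdeg m < N)%N -> coef f m = 0.

Lemma order_geM N N' f g : order_ge N f -> order_ge N' g -> order_ge (N + N') (f * g).
Proof.
move=> fN gN m mN; rewrite (coefM MA); apply: big1 => -[a b] /= /eqP mab.
have [aN|aN] := ltnP (mdeg a) N; first by rewrite fN// mul0r.
rewrite gN ?mulr0// -(ltn_add2l (mdeg a)) -mdegD -mab.
by apply: leq_trans mN _; rewrite leq_add2r.
Qed.

Lemma order_geX N f n : order_ge N f -> order_ge (N * n) (f ^+ n).
Proof.
move=> fN; elim: n => [|n IH]; first by rewrite muln0.
by rewrite exprS mulnS; apply: order_geM.
Qed.

(** Up to any order, identities that are additive need only be checked on terms
    c *: mon u. *)
Lemma polynomial_part N f : exists2 s, order_ge N s &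
  f = \sum_(u : 'X_{1..d < N}) coef f u *: mon u + s.
Proof.
exists (f - \sum_(u : 'X_{1..d < N}) coef f u *: mon u); last by rewrite addrC subrK.
move=> m mN; rewrite coefB coef_sum (bigD1 (BMultinom mN)) //= big1 => [|u um].
  by rewrite coefZ (coef_mon MA) eqxx mulr1 addr0 subrr.
rewrite coefZ (coef_mon MA); case: eqP => [mu|]; last by rewrite mulr0.
by case/eqP: um; apply: val_inj.
Qed.

Local Notation y := (fun j : 'I_d => mon U_(j)%MM).
Let below (j : nat) m := [forall t : 'I_d, (t < j)%N ==> (m t == 0%N)].

Let mask (b : bool) (c : k) : k := if b then c else 0.
Let mask_is_additive b : zmod_morphism (mask b).
Proof. by move=> x z; rewrite /mask; case: b; rewrite ?subr0. Qed.
HB.instance Definition _ b := GRing.isZmodMorphism.Build k k (mask b)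
  (mask_is_additive b).

Let coef_yM (t : 'I_d) f m :
  coef (mon U_(t)%MM * f) m = if m t == 0%N then 0 else coef f (m - U_(t))%MM.
Proof. by rewrite coef_monM lep1mP; case: eqP. Qed.

Let below_eq j m m' : (forall t : 'I_d, (t < j)%N -> m t = m' t) ->
  below j m = below j m'.
Proof.
by move=> mm; apply: eq_forallb => t; case: ltnP => //= /mm ->.
Qed.

(** The coefficient of pr j f at m is that of f if no variable of index below j
    occurs in m, and 0 otherwise; that of dv j f at m is the same with f read at
    m + U_(j). *)
Lemma contraction_exists : exists pr dv,
  contraction y pr dv /\ forall f, pr d f = (coef f 0%MM)%:A.
Proof.
have /choice[pr prE] (j : nat) := @operator id (fun m => mask (below j m)) (fun=> leqnn _).
have /choice[dv dvE] (j : 'I_d) : exists T : {additive R -> R}, forall f m,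
    coef (T f) m = mask (below j m) (coef f (m + U_(j))%MM).
  by apply: operator => m; rewrite mdegD leq_addr.
have below_sub (j : nat) (t : 'I_d) m : (j <= t)%N -> below j (m - U_(t))%MM = below j m.
  move=> jt; apply: below_eq => u uj; rewrite mnmBE mnm1E.
  by rewrite -val_eqE /= gtn_eqF ?subn0// (leq_trans uj).
have addK m (j : 'I_d) : (m + U_(j) - U_(j))%MM = m by rewrite addmK.
have subK m (j : 'I_d) : m j != 0%N -> (m - U_(j) + U_(j))%MM = m.
  by move=> mj; rewrite submK// lep1mP.
exists (fun j => pr j), dv; split; last first.
  move=> f; apply: (coef_inj MA) => m; rewrite prE coef_const /mask.
  rewrite (_ : below d m = (m == 0%MM)); first by case: eqP => [->|].
  apply/forallP/eqP => [m0|-> t]; last by rewrite mnm0E implybT.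
  by apply/mnmP => t; rewrite mnm0E; apply/eqP; have := m0 t; rewrite ltn_ord.
split.
- move=> f; apply: (coef_inj MA) => m; rewrite prE (_ : below 0 m)//.
  by apply/forallP => t.
- move=> j f; apply: (coef_inj MA) => m; rewrite coefD coef_yM !prE dvE.
  have belowS : below j.+1 m = below j m && (m j == 0%N).
    apply/forallP/andP => [mj|[/forallP mj mj0] t].
      split; last by have := mj j; rewrite ltnSn.
      by apply/forallP => t; apply/implyP => tj; have := mj t; rewrite ltnS ltnW.
    apply/implyP; rewrite ltnS leq_eqVlt => /predU1P[/val_inj -> //|tj].
    by have := mj t; rewrite tj.
  rewrite belowS; case: eqP => mj0; first by rewrite andbT addr0.
  by rewrite andbF add0r below_sub// subK//; apply/eqP.
- move=> t j f tj; apply: (coef_inj MA) => m; rewrite dvE coef0 coef_yM /mask.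
  case: ifP => // /forallP/(_ t); rewrite tj /= => mt.
  have jNt : (j == t) = false by rewrite -val_eqE /= gtn_eqF.
  by rewrite mnmDE mnm1E jNt addn0 mt.
- move=> t j f jt; apply: (coef_inj MA) => m; rewrite dvE !coef_yM dvE.
  have jNt : (j == t) = false by rewrite -val_eqE /= ltn_eqF.
  rewrite mnmDE mnm1E jNt addn0; case: ifPn => mt; first by rewrite raddf0.
  rewrite below_sub ?(ltnW jt)//; congr (mask _ (coef f _)).
  by rewrite addmC -addmBA ?lep1mP// addmC.
move=> j f; apply: (coef_inj MA) => m; rewrite dvE prE coef_yM addK.
by rewrite mnmDE mnm1E eqxx addn1.
Qed.

Lemma monomial_koszul_exact : koszul_exact y R^o.
Proof.
have [pr [dv [ctr _]]] := contraction_exists.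
by move=> i x; apply: (koszul_acyclic ctr).
Qed.

Lemma monomial_residue f : exists (c : k) (s : 'I_d -> R),
  f = c%:A + \sum_j s j * y j.
Proof.
have [pr [dv [ctr prd]]] := contraction_exists.
exists (coef f 0%MM), (fun j => dv j f); rewrite -prd.
have := pr_sum ctr f (leqnn d).
rewrite (eq_bigl predT) => [|t]; last by rewrite ltn_ord.
move=> E; under eq_bigr do rewrite mulrC.
by rewrite E addrC subrK.
Qed.

End MonomialAlgebraTheory.

(** * Cartier maps and flatness of the Frobenius endomorphism *)

Section CartierMaps.
Variables (k : fieldType) (d : nat) (R : comAlgType k).
Variables (coef : R -> 'X_{1..d} -> k) (mon : 'X_{1..d} -> R).
Hypothesis MA : monomial_algebra coef mon.
Variable p : nat.
Hypothesis charkp : p \in [pchar k].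
Implicit Types (f g h : R) (m u v w : 'X_{1..d}).

Let charRp : p \in [pchar R]. Proof. by rewrite (fmorph_pchar (in_alg R)). Qed.
Let p_gt0 := pchar_gt0 charkp.

Let FrD := powpD charRp.
Let Fr_sum := powp_sum charRp.

Lemma term_pow c u : (c *: mon u) ^+ p = c ^+ p *: mon (u *+ p)%MM.
Proof. by rewrite exprZn (monX MA). Qed.

Lemma mnm_mulp_inj u v : (u *+ p = v *+ p)%MM -> u = v.
Proof.
move=> uv; apply/mnmP => i; have /mnmP/(_ i) := uv; rewrite !mulmnE => /eqP.
by rewrite eqn_pmul2r// => /eqP.
Qed.

Lemma coef_powp g m : coef (g ^+ p) m =
  \sum_(u : 'X_{1..d < (mdeg m).+1}) coef g u ^+ p * (m == (u *+ p)%MM)%:R.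
Proof.
have [s sN gE] := polynomial_part MA (mdeg m).+1 g.
rewrite {1}gE FrD (coefD MA) Fr_sum (coef_sum MA).
rewrite [X in _ + X](order_geX MA (n := p) sN) ?addr0; last first.
  by apply: leq_trans (ltnSn _) _; rewrite leq_pmulr.
by apply: eq_bigr => u _; rewrite term_pow (coefZ MA) (coef_mon MA).
Qed.

Lemma coef_powp_mul g v : coef (g ^+ p) (v *+ p)%MM = coef g v ^+ p.
Proof.
rewrite coef_powp.
have vd : (mdeg v < (mdeg (v *+ p)%MM).+1)%N by rewrite ltnS mdegMn leq_pmulr.
rewrite (bigD1 (BMultinom vd)) //= eqxx mulr1 big1 ?addr0// => u uv.
case: eqP => [/mnm_mulp_inj vu|]; last by rewrite mulr0.
by case/eqP: uv; apply: val_inj.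
Qed.

Lemma coef_powp_notmul g m : (forall v, m <> (v *+ p)%MM) -> coef (g ^+ p) m = 0.
Proof.
move=> mN; rewrite coef_powp big1// => u _.
by case: eqP => [/mN|]; rewrite ?mulr0.
Qed.

Lemma digits_le u m w : (forall i, w i < p)%N ->
  (u *+ p <= m *+ p + w)%MM = (u <= m)%MM.
Proof.
move=> wp; apply/mnm_lepP/mnm_lepP => um i; have := um i; rewrite mnmDE !mulmnE.
  move=> H; rewrite -ltnS -(ltn_pmul2r p_gt0) mulSn addnC.
  by apply: leq_ltn_trans H _; rewrite ltn_add2l.
by move=> H; apply: leq_trans (leq_addr _ _); rewrite leq_pmul2r.
Qed.

(** The component of f along Y^w for the decomposition of R over the p-th powers of
    the variables, with lam applied to its coefficients. *)
Definition cartier (lam : {additive k -> k}) w (T : {additive R -> R}) :=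
  forall f m, coef (T f) m = lam (coef f (m *+ p + w)%MM).

Lemma cartier_exists lam w : exists T, cartier lam w T.
Proof.
apply: (operator MA (fun=> lam) (sig := fun m => (m *+ p + w)%MM)) => m.
by rewrite mdegD mdegMn; apply: leq_trans (leq_addr _ _); rewrite leq_pmulr.
Qed.

(** On terms r = c Y^u the identity is a computation on exponents, where w < p makes
    p u <= p m + w equivalent to u <= m. It extends by additivity: the part of r of
    order > deg m + d affects the coefficient at m of neither side. *)
Lemma cartier_semilinear lam w T : pinv_linear p lam -> (forall i, w i < p)%N ->
  cartier lam w T -> forall r f, T (r ^+ p * f) = r * T f.
Proof.
move=> lamP wp TE r f.
have term c u : T ((c *: mon u) ^+ p * f) = (c *: mon u) * T f.
  apply: (coef_inj MA) => m; rewrite TE term_pow -!scalerAl !(coefZ MA) lamP.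
  rewrite !(coef_monM MA) digits_le//; congr (_ * _).
  case: ifP => um; last by rewrite raddf0.
  rewrite TE; congr (lam (coef f _)); apply/mnmP => i.
  rewrite !(mnmE, mulmnE) mulnBl addnBAC// leq_pmul2r//.
  by move/mnm_lepP: um.
apply: (coef_inj MA) => m.
have [s sN ->] := polynomial_part MA (mdeg m + d).+1 r.
rewrite FrD !mulrDl raddfD !(coefD MA).
have spN : order_ge coef ((mdeg m + d).+1 * p + 0) (s ^+ p * f).
  by apply: (order_geM MA) => //; apply: (order_geX MA).
have -> : coef (T (s ^+ p * f)) m = 0.
  (* The coefficient at m is read at p m + w, of degree at most p (deg m + d). *)
  have wd : (mdeg w <= d * p)%N.
    rewrite mdegE -[d in (d * p)%N]card_ord -sum_nat_const.
    by apply: leq_sum => i _; apply/ltnW/wp.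
  rewrite TE spN ?raddf0// addn0 mdegD mdegMn mulSn mulnDl addnCA ltn_add2l.
  by apply: leq_ltn_trans wd _; rewrite -{1}[(d * p)%N]add0n ltn_add2r.
have -> : coef (s * T f) m = 0.
  have : order_ge coef ((mdeg m + d).+1 + 0) (s * T f) by apply: (order_geM MA).
  by apply; rewrite addn0 ltnS leq_addr.
congr (_ + 0); rewrite Fr_sum !mulr_suml raddf_sum !(coef_sum MA).
by apply: eq_bigr => u _; rewrite /= term.
Qed.

Let digit (w : {ffun 'I_d -> 'I_p}) : 'X_{1..d} := [multinom (w i : nat) | i < d].

(** Only the exponent w = m mod p contributes to the coefficient at m. *)
Lemma cartier_expansion (lam : {additive k -> k})
    (T : {ffun 'I_d -> 'I_p} -> {additive R -> R}) :
  (forall a, cartier lam (digit a) (T a)) -> forall f m,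
  coef (\sum_a mon (digit a) * T a f ^+ p) m = lam (coef f m) ^+ p.
Proof.
move=> TE f m; rewrite (coef_sum MA).
pose w0 : {ffun 'I_d -> 'I_p} := [ffun i => Ordinal (ltn_pmod (m i) p_gt0)].
pose v0 : 'X_{1..d} := [multinom (m i %/ p)%N | i < d].
have mE : m = (v0 *+ p + digit w0)%MM.
  by apply/mnmP => i; rewrite !(mnmE, mulmnE) ffunE /= -divn_eq.
rewrite (bigD1 w0) //= [X in _ + X]big1 ?addr0 => [|a aw0].
  rewrite (coef_monM MA) {1}mE lem_addl [in (m - _)%MM]mE addmK coef_powp_mul TE.
  by rewrite -mE.
rewrite (coef_monM MA); case: ifP => // wm; apply: coef_powp_notmul => v mv.
case/eqP: aw0; apply/ffunP => i; apply: val_inj; rewrite ffunE /=.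
rewrite -(submK wm) mv !(mnmE, mulmnE) modnMDl modn_small//.
Qed.

(** The functionals are those of a finite part of k that contains the coefficients
    of interest. Coefficients outside X are not controlled, except that zero
    coefficients stay zero, which makes the expression exact for polynomials. *)
Lemma cartier_approx r (b : 'I_r -> R) (X : seq k) :
  exists (T : finType) (c : T -> R) (z : T -> 'I_r -> R),
    (forall n (g : 'I_r -> {ffun 'I_n -> R^o}),
       (forall l, \sum_i b i * (g i l : R) ^+ p = 0) ->
       forall t, \sum_i z t i *: g i = 0) /\
    (forall i u, coef (b i) u \in 0 :: X ->
       coef (\sum_t c t * z t i ^+ p) u = coef (b i) u).
Proof.
have [s sX] := pinv_dual_basis charkp (0 :: X).
pose lam (a : 'I_(size s)) := (tnth (in_tuple s) a).2.
have /choice[T TE] (aw : 'I_(size s) * {ffun 'I_d -> 'I_p}) :=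
  cartier_exists (sval (lam aw.1)) (digit aw.2).
exists ('I_(size s) * {ffun 'I_d -> 'I_p})%type.
exists (fun aw => (tnth (in_tuple s) aw.1).1 *: mon (digit aw.2)).
exists (fun aw i => T aw (b i)); split=> [n g bg t|i u uX].
  apply/ffunP => l; rewrite sum_ffunE [RHS]ffunE.
  transitivity (T t (\sum_i b i * (g i l : R) ^+ p)); last by rewrite bg raddf0.
  rewrite raddf_sum; apply: eq_bigr => i _; rewrite ffunE /=.
  rewrite [b i * _]mulrC (cartier_semilinear _ _ (TE t)); first exact: mulrC.
    exact: (svalP (lam t.1)).
  by move=> j; rewrite mnmE ltn_ord.
rewrite -[RHS](sX _ uX) (big_tnth _ _ s).
transitivity (coef (\sum_a \sum_e
    ((tnth (in_tuple s) a).1 *: mon (digit e)) * T (a, e) (b i) ^+ p) u).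
  by rewrite pair_bigA; congr (coef _ u); apply: eq_bigr => -[a e].
rewrite (coef_sum MA); apply: eq_bigr => a _.
under eq_bigr do rewrite -scalerAl.
rewrite -scaler_sumr (coefZ MA); congr (_ * _).
have TEa e : cartier (sval (lam a)) (digit e) (T (a, e)) := TE (a, e).
by rewrite -(cartier_expansion TEa).
Qed.

End CartierMaps.

(** * Polynomial rings are Noetherian *)

Section FiniteGeneration.
Variable (A : comNzRingType).

(** Generators of the ideal of first coordinates of Z are lifted to Z, and completed
    by generators of the part of Z with zero first coordinate. *)
Lemma noetherian_free_of_ideals :
  (forall I : A^o -> Prop, submodule I ->
     exists (T : finType) (g : T -> A), (forall i, I (g i)) /\
       forall z, I z -> exists c : T -> A, z = \sum_i c i * g i) ->
  noetherian_free A.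
Proof.
move=> ideal_fg; elim=> [|n IH] Z Zsub; have [Z0 ZS] := Zsub.
  exists (void : finType), (fun=> 0); split=> [[]//|z _]; exists (fun=> 0).
  by apply/ffunP => -[].
pose cons0 (w : {ffun 'I_n -> A^o}) : {ffun 'I_n.+1 -> A^o} :=
  [ffun i => if unlift ord0 i is Some j then w j else 0].
have cons0_lin c u v : cons0 (c *: u + v) = c *: cons0 u + cons0 v.
  apply/ffunP => i; rewrite !ffunE; case: unlift => [j|]; rewrite ?ffunE//.
  by rewrite scaler0 addr0.
have cons00 : cons0 0 = 0.
  by apply/ffunP => i; rewrite !ffunE; case: unlift => [j|]; rewrite ?ffunE.
have [|T [a [aI agen]]] := ideal_fg (fun a => exists z, Z z /\ z ord0 = a).
  split=> [|c u v [z [Zz <-]] [z' [Zz' <-]]]; first by exists 0; rewrite ffunE.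
  by exists (c *: z + z'); split; [exact: ZS|rewrite !ffunE].
have /choice[z /all_and2[Zz z0]] := aI.
have [|T' [w [Zw wgen]]] := IH (fun w => Z (cons0 w)).
  by split=> [|c u v]; rewrite ?cons00// cons0_lin; apply: ZS.
exists (T + T')%type, (fun i => match i with inl i => z i | inr i => cons0 (w i) end).
split=> [[i|i]|v Zv]; [exact: Zz|exact: Zw|].
have [c cE] : exists c : T -> A, v ord0 = \sum_i c i * a i by apply: agen; exists v.
pose v' := v - \sum_i c i *: z i.
have v'0 : v' ord0 = 0.
  rewrite !ffunE sum_ffunE cE; apply/eqP; rewrite subr_eq0; apply/eqP.
  by apply: eq_bigr => i _; rewrite ffunE z0.
pose w' : {ffun 'I_n -> A^o} := [ffun j => v' (fintype.lift ord0 j)].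
have v'E : v' = cons0 w'.
  apply/ffunP => i; rewrite [RHS]ffunE; case: (unliftP ord0 i) => [j ->|->]; last exact: v'0.
  by rewrite [RHS]ffunE.
have [|c' c'E] := wgen w'.
  by rewrite -v'E; apply: (submoduleB Zsub) => //; apply: submodule_sum.
exists (fun i => match i with inl i => c i | inr i => c' i end).
rewrite big_sumType /= -[v](subrK (\sum_i c i *: z i)) -/v' addrC; congr (_ + _).
rewrite v'E c'E; rewrite unlock; elim: (index_enum T') => //= i s IHs.
by rewrite cons0_lin IHs.
Qed.

(** Finitely many elements of G already generate its span: each of finitely many
    generators of the span involves finitely many elements of G. *)
Lemma finite_subfamily n (G : {ffun 'I_n -> A^o} -> Prop) : noetherian_free A ->
  exists (T : finType) (h : T -> {ffun 'I_n -> A^o}), (forall i, G (h i)) /\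
    forall v, spanned G v -> exists c : T -> A, v = \sum_i c i *: h i.
Proof.
move=> noeth.
have [T [w [Gw wgen]]] := noeth n _ (spanned_submodule G).
have /choice[s sP] i : exists s : seq (A * {ffun 'I_n -> A^o}),
    (forall z, z \in s -> G z.2) /\ w i = \sum_(z <- s) z.1 *: z.2.
  by have [s sG wE] := Gw i; exists s.
exists {i : T & 'I_(size (s i))}.
exists (fun ij => (tnth (in_tuple (s (tag ij))) (tagged ij)).2); split=> [[i j]|v Gv].
  by apply: (sP i).1; apply: mem_tnth.
have [c ->] := wgen v Gv.
exists (fun ij => c (tag ij) * (tnth (in_tuple (s (tag ij))) (tagged ij)).1).
transitivity (\sum_i \sum_(j < size (s i))
  (c i * (tnth (in_tuple (s i)) j).1) *: (tnth (in_tuple (s i)) j).2); last first.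
  by rewrite sig_big_dep.
apply: eq_bigr => i _; rewrite (sP i).2 scaler_sumr big_tnth.
by apply: eq_bigr => j _; rewrite scalerA.
Qed.

End FiniteGeneration.

Section Polynomials.
Import Order.TTheory.
Variables (k : fieldType) (d : nat).
Implicit Types (m u v : 'X_{1..d}).

(** Induction on the set F of coordinates that are not constant on M. If t lies in M
    then an element of M that t does not divide has a smaller value c < t_i at some
    coordinate i, so it lies in one of finitely many slices of M, on which the
    coordinate i is constant too. *)
Lemma dickson (M : 'X_{1..d} -> Prop) : exists s : seq 'X_{1..d},
  (forall u, u \in s -> M u) /\ forall m, M m -> exists2 u, u \in s & (u <= m)%MM.
Proof.
suff gen n (F : {set 'I_d}) (N : 'X_{1..d} -> Prop) : (#|F| <= n)%N ->
    (forall u v i, N u -> N v -> i \notin F -> u i = v i) ->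
    exists s : seq 'X_{1..d}, (forall u, u \in s -> N u) /\
      forall m, N m -> exists2 u, u \in s & (u <= m)%MM.
  by apply: (gen d setT) => [|u v i _ _]; rewrite ?cardsT ?card_ord// inE.
elim: n F N => [|n IH] F N Fn const.
  have [[t Nt]|NN] := pselect (exists t, N t); last first.
    by exists [::]; split=> // m Nm; case: NN; exists m.
  exists [:: t]; split=> [u|m Nm]; first by rewrite inE => /eqP ->.
  exists t; first exact: mem_head.
  apply/mnm_lepP => i; rewrite (const t m)//.
  by move: Fn; rewrite leqn0 cards_eq0 => /eqP ->; rewrite inE.
have [[t Nt]|NN] := pselect (exists t, N t); last first.
  by exists [::]; split=> // m Nm; case: NN; exists m.
have /choice[s sP] (ic : 'I_d * nat) : exists s : seq 'X_{1..d}, ic.1 \in F ->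
    (forall u, u \in s -> N u /\ u ic.1 = ic.2) /\
    forall m, N m /\ m ic.1 = ic.2 -> exists2 u, u \in s & (u <= m)%MM.
  have [iF|_] := boolP (ic.1 \in F); last by exists [::].
  have [|u v j [Nu ui] [Nv vi]|s ?] := IH (F :\ ic.1) (fun m => N m /\ m ic.1 = ic.2).
  - by move: Fn; rewrite (cardsD1 ic.1) iF.
  - rewrite !inE negb_and negbK => /orP[/eqP ->|]; first by rewrite ui vi.
    exact: const.
  by exists s.
exists (t :: flatten [seq flatten [seq s (i, c) | c <- iota 0 (t i)] | i <- enum F]).
split=> [u|m Nm].
  rewrite inE => /predU1P[-> //|/flatten_mapP[i]]; rewrite mem_enum => iF.
  by move=> /flatten_mapP[c _ /(sP (i, c) iF).1[]].
have [tm|] := boolP (t <= m)%MM; first by exists t; rewrite ?mem_head.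
move=> /mnm_lepP/existsNP[i /negP]; rewrite -ltnNge => mt.
have iF : i \in F by apply: contraLR mt => iF; rewrite (const t m)// ltnn.
have [u us um] := (sP (i, m i) iF).2 m (conj Nm erefl).
exists u => //; rewrite inE; apply/orP; right; apply/flatten_mapP.
exists i; first by rewrite mem_enum.
by apply/flatten_mapP; exists (m i); rewrite ?mem_iota.
Qed.

(** Division by elements of the ideal whose leading monomials generate all leading
    monomials terminates with remainder zero, the monomial order being
    well-founded. *)
Lemma mpoly_noetherian : noetherian_free {mpoly k[d]}.
Proof.
apply: noetherian_free_of_ideals => I [I0 ILin].
have IS (c u v : {mpoly k[d]}) : I u -> I v -> I (c * u + v) by apply: ILin.
have [s [sP sdvd]] := dickson (fun m => exists f : {mpoly k[d]},
  [/\ I f, f != 0 & mlead f = m]).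
have /choice[g gP] (i : 'I_(size s)) : exists f : {mpoly k[d]},
    [/\ I f, f != 0 & mlead f = tnth (in_tuple s) i].
  by apply: sP; apply: mem_tnth.
exists 'I_(size s), g; split=> [i|z]; first by case: (gP i).
have gen_add (c : {mpoly k[d]}) i f :
    (exists a : 'I_(size s) -> {mpoly k[d]}, f = \sum_i a i * g i) ->
    exists a : 'I_(size s) -> {mpoly k[d]}, c * g i + f = \sum_i a i * g i.
  move=> [a ->]; exists (fun j => (if j == i then c else 0) + a j).
  under [RHS]eq_bigr do rewrite mulrDl; rewrite big_split /=; congr (_ + _).
  rewrite (bigD1 i) //= eqxx big1 ?addr0// => j /negbTE ->.
  by rewrite mul0r.
have zero : exists a : 'I_(size s) -> {mpoly k[d]}, 0 = \sum_i a i * g i.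
  by exists (fun=> 0); rewrite big1// => i _; rewrite mul0r.
move: {2}(mlead z) (erefl (mlead z)) => m; elim/(well_founded_ind (@ltom_wf d)): m z.
move=> m IH f fm If; have [->//|f0] := eqVneq f 0.
have [u us uf] : exists2 u, u \in s & (u <= mlead f)%MM by apply: sdvd; exists f.
have /tnthP[i ui] : u \in in_tuple s := us.
have [Ig g0 gu] := gP i; rewrite -ui in gu.
have lg : mleadc (g i) != 0 by rewrite mleadc_eq0.
have lf : mleadc f != 0 by rewrite mleadc_eq0.
pose q : {mpoly k[d]} := (mleadc f / mleadc (g i)) *: 'X_[mlead f - u].
have c0 : mleadc f / mleadc (g i) != 0 by rewrite mulf_neq0// invr_eq0.
have qlead : q@_(mlead f - u)%MM = mleadc f / mleadc (g i).
  by rewrite mcoeffZ mcoeffX eqxx mulr1.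
have q0 : q != 0 by apply: contraNneq c0 => q0; rewrite -qlead q0 mcoeff0.
have leadq : mlead q = (mlead f - u)%MM by rewrite mleadZ// mleadXm.
have leadqg : mlead (q * g i) = mlead f by rewrite mleadM// leadq gu submK.
have If' : I (f - q * g i) by rewrite addrC -mulNr; apply: IS.
rewrite -[f](subrKC (q * g i)); apply: gen_add.
have [->//|f'0] := eqVneq (f - q * g i) 0.
apply: (IH (mlead (f - q * g i))) => //; rewrite -fm lt_neqAle.
apply/andP; split; last first.
  by apply: le_trans (mleadB_le _ _) _; rewrite leadqg joinxx.
apply: contraNneq f'0 => lead_eq; rewrite -mleadc_eq0 lead_eq mcoeffB.
have -> : (q * g i)@_(mlead f) = mleadc f.
  rewrite -[in LHS]leadqg (mleadM q0 g0) mleadcM leadq qlead.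
  by rewrite divfK.
by rewrite subrr.
Qed.

End Polynomials.

(** * Submodules over power series rings *)

Section PowerSeries.
Variables (k : fieldType) (d : nat).
Implicit Types (m : 'X_{1..d}).
Local Notation S := (mfps d k).
Local Notation coef := (@mfps_coef d k).

Definition mfps_mon (u : 'X_{1..d}) : S := MFps (fun m => if m == u then 1 else 0).

Lemma mfps_monomial_algebra : monomial_algebra coef mfps_mon.
Proof.
split=> //.
- exact: mfpsP.
- by move=> u m /=; case: eqP.
by move=> f sig tau _ _; exists (MFps (fun m => tau m (coef f (sig m)))).
Qed.

Let MA := mfps_monomial_algebra.

Lemma mpoly_monomial_algebra :
  monomial_algebra (fun (f : {mpoly k[d]}) m => f@_m) (fun m => 'X_[m]).
Proof.
split.
- by move=> f g fg; apply/mpolyP.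
- by move=> c f g m; rewrite mcoeffD mcoeffZ.
- by move=> u m; rewrite mcoeffX eq_sym.
- exact: mpolyX0.
- exact: mcoeffM.
move=> f sig tau sigP tau0.
exists (\sum_(m : 'X_{1..d < msize f}) tau m f@_(sig m) *: 'X_[m]) => m.
have [mf|fm] := ltnP (mdeg m) (msize f).
  exact: (mcoeff_mpoly (fun m => tau m f@_(sig m))).
rewrite [in RHS]memN_msupp_eq0 ?tau0; last first.
  by apply: msize_mdeg_ge; apply: leq_trans (sigP m).
rewrite linear_sum big1// => u _; rewrite /= mcoeffZ mcoeffX.
case: eqP => [um|]; last by rewrite mulr0.
by have := bmdeg u; rewrite um ltnNge fm.
Qed.

Section Closed.
Variables (n : nat) (Z : {ffun 'I_n -> S^o} -> Prop).
Hypothesis Zsub : submodule Z.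

(** Membership in the closure of Z for the Y-adic topology. *)
Definition adherent (v : {ffun 'I_n -> S^o}) := forall N, exists2 z, Z z &
  forall l u, (mdeg u < N)%N -> coef (v l) u = coef (z l) u.

(** N is only a lower bound for the order of z, so that w may also be 0: this spares
    a nonvanishing condition. *)
Definition initial_form (w : {ffun 'I_n -> {mpoly k[d]}^o}) :=
  exists N z, [/\ Z z, forall l, order_ge coef N (z l) &
    forall l u, (w l)@_u = if mdeg u == N then coef (z l) u else 0].

Section Lifting.
Variables (T : finType) (h : T -> {ffun 'I_n -> {mpoly k[d]}^o}).
Variables (g : T -> {ffun 'I_n -> S^o}) (D : T -> nat).
Hypotheses (Zg : forall i, Z (g i))
  (gD : forall i l, order_ge coef (D i) (g i l))
  (hE : forall i l u, (h i l)@_u = if mdeg u == D i then coef (g i l) u else 0)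
  (hgen : forall w, spanned initial_form w ->
     exists q : T -> {mpoly k[d]}, w = \sum_i q i *: h i).

(** Modulo degree N + 1, b is an element of Z, so its part of degree N is an initial
    form and a combination sum_i q_i h_i. Only the part of q_i of degree N - D_i
    matters, and the corresponding combination of the g_i has the same part of
    degree N as b and no lower terms. *)
Lemma lift_initial_form N (b : {ffun 'I_n -> S^o}) :
  adherent b -> (forall l, order_ge coef N (b l)) ->
  exists c : T -> S, (forall i u, coef (c i) u != 0 -> (mdeg u + D i)%N = N) /\
    forall l, order_ge coef N.+1 ((b - \sum_i c i *: g i) l).
Proof.
move=> badh bN; have [z Zz bz] := badh N.+1.
pose w : {ffun 'I_n -> {mpoly k[d]}^o} := [ffun l =>
  \sum_(u : 'X_{1..d < N.+1}) (if mdeg u == N then coef (z l) u else 0) *: 'X_[u]].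
have wE l u : (w l)@_u = if mdeg u == N then coef (z l) u else 0.
  rewrite ffunE; have [uN|Nu] := ltnP (mdeg u) N.+1.
    exact: (mcoeff_mpoly (fun u => if mdeg u == N then coef (z l) u else 0)).
  rewrite gtn_eqF// linear_sum big1// => m _; rewrite /= mcoeffZ mcoeffX.
  have [mu|] := eqVneq (m : 'X_{1..d}) u; last by rewrite mulr0.
  by have := bmdeg m; rewrite mu ltnNge Nu.
have [|q wq] := hgen (w := w).
  apply/asboolP/span_gen; exists N, z; split=> // l u uN.
  by rewrite -bz ?bN// ltnW.
pose c i : S := MFps (fun u => if (mdeg u + D i == N)%N then (q i)@_u else 0).
exists c; split=> [i u|l u uN]; first by rewrite /=; case: (_ =P N) => // _; rewrite eqxx.
rewrite !ffunE sum_ffunE (coefB MA) (coef_sum MA).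
have prodE i : coef ((c i *: g i) l) u = if mdeg u == N then (q i * h i l)@_u else 0.
  rewrite ffunE [coef _ u](coefM MA); case: eqP => uN'.
    rewrite mcoeffM; apply: eq_bigr => -[a1 a2] /= /eqP ua.
    have := uN'; rewrite {1}ua mdegD hE => aN.
    rewrite -aN eqn_add2l eq_sym; case: eqP => _ //.
    by rewrite mul0r mulr0.
  apply: big1 => -[a1 a2] /= /eqP ua; case: eqP => [aN|]; last by rewrite mul0r.
  rewrite gD ?mulr0// -(ltn_add2l (mdeg a1)) aN -mdegD -ua ltn_neqAle.
  by rewrite -ltnS uN andbT; apply/eqP.
rewrite (eq_bigr _ (fun i _ => prodE i)).
have [uN'|uN'] := eqVneq (mdeg u) N; last first.
  by rewrite big1// bN ?subr0// ltn_neqAle uN'.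
rewrite bz// (_ : coef (z l) u = (w l)@_u); last by rewrite wE uN' eqxx.
rewrite wq sum_ffunE linear_sum; apply/eqP; rewrite subr_eq0; apply/eqP.
by apply: eq_bigr => i _; rewrite ffunE.
Qed.

(** Successive approximation: b_N is what remains of v, of order at least N, after
    the degrees below N have been removed. The coefficient of c_i at a monomial u is
    determined at the single step N = deg u + D_i, so that the sum over all steps is
    a well-defined power series. *)
Lemma adherent_generated v : adherent v -> exists c : T -> S, v = \sum_i c i *: g i.
Proof.
move=> vadh.
have /choice[C CP] (Nb : nat * {ffun 'I_n -> S^o}) : exists c : T -> S,
    adherent Nb.2 -> (forall l, order_ge coef Nb.1 (Nb.2 l)) ->
    (forall i u, coef (c i) u != 0 -> (mdeg u + D i)%N = Nb.1) /\
    forall l, order_ge coef Nb.1.+1 ((Nb.2 - \sum_i c i *: g i) l).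
  have [badh|?] := pselect (adherent Nb.2); last by exists (fun=> 0).
  have [bN|?] := pselect (forall l, order_ge coef Nb.1 (Nb.2 l)); last first.
    by exists (fun=> 0).
  by have [c cP] := lift_initial_form badh bN; exists c.
pose b := fix b N := if N is M.+1 then b M - \sum_i C (M, b M) i *: g i else v.
pose CN N := C (N, b N).
have bP N : adherent (b N) /\ forall l, order_ge coef N (b N l).
  elim: N => [//|N [badh bN]].
  have [_ bN1] := CP (N, b N) badh bN; split=> [M|]; last exact: bN1.
  have [z Zz zb] := badh M; exists (z - \sum_i CN N i *: g i).
    by apply: (submoduleB Zsub) => //; apply: submodule_sum.
  by move=> l u uM; rewrite [in RHS]ffunE [in LHS]ffunE !(coefD MA) zb.
have CNP N i u : coef (CN N i) u != 0 -> (mdeg u + D i)%N = N.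
  by have [badh bN] := bP N; apply: (CP (N, b N) badh bN).1.
have vE N : v = b N + \sum_(M < N) \sum_i CN M i *: g i.
  elim: N => [|N IH]; first by rewrite big_ord0 addr0.
  by rewrite big_ord_recr /= -/(CN N) addrACA addNr addr0.
exists (fun i => MFps (fun u => coef (CN (mdeg u + D i)%N i) u)).
apply/ffunP => l; apply: mfpsP => u; rewrite (vE (mdeg u).+1) ffunE (coefD MA).
rewrite (bP _).2// add0r exchange_big !sum_ffunE !(coef_sum MA).
apply: eq_bigr => i _; rewrite -scaler_suml !ffunE.
rewrite ![coef _ u](coefM MA); apply: eq_bigr => -[a1 a2] /= /eqP ua.
have [a2D|Da2] := ltnP (mdeg a2) (D i); first by rewrite gD// !mulr0.
have a1u : (mdeg a1 + D i < (mdeg u).+1)%N.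
  by rewrite ltnS [in X in (_ <= X)%N]ua mdegD leq_add2l.
rewrite (coef_sum MA) (bigD1 (Ordinal a1u)) //= big1 ?addr0// => M ne.
apply: contraNeq ne => /CNP aM; apply/eqP/val_inj; exact: esym.
Qed.
End Lifting.

(** The generators of Z also generate its closure, because each step of the
    approximation uses an element of Z only up to a finite degree. *)
Lemma mfps_submodule_closed : exists (T : finType) (g : T -> {ffun 'I_n -> S^o}),
  (forall i, Z (g i)) /\
  forall v, adherent v -> exists c : T -> S, v = \sum_i c i *: g i.
Proof.
have [T [h [hG hgen]]] := finite_subfamily initial_form (@mpoly_noetherian k d).
have /choice[D /choice[g gP]] := hG.
exists T, g; split=> [i|v]; first by case: (gP i).
apply: (@adherent_generated T h g D) => //.
- by move=> i; case: (gP i).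
- by move=> i; case: (gP i).
by move=> i; case: (gP i).
Qed.

End Closed.

Lemma mfps_noetherian : noetherian_free S.
Proof.
move=> n Z Zsub; have [T [g [Zg gen]]] := mfps_submodule_closed Zsub.
by exists T, g; split=> // z Zz; apply: gen => N; exists z.
Qed.

(** * Flatness of Frobenius for polynomials and power series *)

Variable p : nat.
Hypothesis charkp : p \in [pchar k].

Lemma mpoly_frob_flat : frob_flat p {mpoly k[d]}.
Proof.
move=> n r g b bg.
pose X := flatten [seq [seq (b i)@_u | u <- msupp (b i)] | i <- enum 'I_r].
have [T [c [z [zg bE]]]] := cartier_approx mpoly_monomial_algebra charkp b X.
exists T, c, z; split=> [|i]; first exact: zg.
apply/mpolyP => u; rewrite bE// inE; have [|ub] := boolP (u \in msupp (b i)).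
  move=> ub; apply/orP; right; apply/flatten_mapP; exists i.
    by rewrite mem_enum.
  exact: map_f.
by rewrite /= memN_msupp_eq0 ?eqxx.
Qed.

(** The span of the p-th powers of the relations between the g_i contains elements
    that agree with b up to any degree, and it is closed. *)
Lemma mfps_frob_flat : frob_flat p S.
Proof.
move=> n r g b bg.
pose G (w : {ffun 'I_r -> S^o}) := exists2 z : {ffun 'I_r -> S^o},
  \sum_i (z i : S) *: g i = 0 & w = fpow p z.
have [T [w [Gw wgen]]] := mfps_submodule_closed (spanned_submodule G).
have [|c bE] := wgen [ffun i => b i].
  move=> N; pose X := flatten [seq
    [seq coef (b i) (u : 'X_{1..d < N}) | u <- enum {: 'X_{1..d < N}}]
    | i <- enum 'I_r].
  have [T' [c [z [zg bE]]]] := cartier_approx mfps_monomial_algebra charkp b X.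
  exists (\sum_t c t *: fpow p [ffun i => z t i]).
    apply: submodule_sum => [|t]; first exact: spanned_submodule.
    apply/asboolP/span_gen.
    exists [ffun i => z t i] => //.
    by rewrite -[RHS](zg n g bg t); apply: eq_bigr => i _; rewrite ffunE.
  move=> l u uN; rewrite ffunE -bE; last first.
    rewrite inE; apply/orP; right; apply/flatten_mapP; exists l.
      by rewrite mem_enum.
    by apply/mapP; exists (BMultinom uN); rewrite ?mem_enum.
  by congr (coef _ u); rewrite sum_ffunE; apply: eq_bigr => t _; rewrite !ffunE.
have : spanned G [ffun i => b i] 
  by rewrite bE; apply: submodule_sum => //; apply: spanned_submodule.
case=> s sG sE.
have /choice[z zP] (t : 'I_(size s)) : exists z : {ffun 'I_r -> S^o},
    \sum_i (z i : S) *: g i = 0 /\ (tnth (in_tuple s) t).2 = fpow p z.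
  by have [z zg zE] := sG _ (mem_tnth t (in_tuple s)); exists z.
exists 'I_(size s), (fun t => (tnth (in_tuple s) t).1), (fun t i => z t i).
split=> [t|i]; first by case: (zP t).
have /ffunP/(_ i) := sE; rewrite ffunE => ->; rewrite big_tnth sum_ffunE.
by apply: eq_bigr => t _; rewrite (zP t).2 !ffunE.
Qed.

End PowerSeries.

(** * Koszul homology of F-finite modules *)

Theorem corollary1p2 (p : nat) (k : fieldType)
    (k_infinite : infinite_set [set: k]%classic) (k_char : p \in [pchar k])
    (d : nat) :
  (forall L : F_module {mpoly k[d]} p, F_finite L ->
     forall i : nat, (i <= d)%N ->
       fin_dim (koszul_homology (fun j : 'I_d => 'X_j : {mpoly k[d]}) L i)) /\
  (forall L : F_module (mfps d k) p, F_finite L ->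
     forall i : nat, (i <= d)%N ->
       fin_dim (koszul_homology (fun j : 'I_d => mfpsX k j) L i)).
Proof.
split=> L Lfin i _.
  have MA := mpoly_monomial_algebra k d.
  apply: (@fin_dim_koszul_F_finite k {mpoly k[d]} d (fun j => 'X_j) p _ _ _ _ _ L i Lfin).
  - by rewrite (fmorph_pchar (in_alg {mpoly k[d]})).
  - exact: mpoly_noetherian.
  - exact: mpoly_frob_flat.
  - exact: (monomial_koszul_exact MA).
  - exact: (monomial_residue MA).
have MA := mfps_monomial_algebra k d.
apply: (@fin_dim_koszul_F_finite k (mfps d k) d (fun j => mfpsX k j) p _ _ _ _ _ L i Lfin).
- by rewrite (fmorph_pchar (in_alg (mfps d k))).
- exact: mfps_noetherian.
- exact: mfps_frob_flat.
- exact: (monomial_koszul_exact MA).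
exact: (monomial_residue MA).
Qed.
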